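(* Let $k$ be a positive integer and let $G$ be a compact (Hausdorff) group with $\mathbf{np}_k(G)>0$. Then the connected component $G^0$ of $G$ is abelian, and there exists a closed normal nilpotent subgroup $N$ of $G$, of class at most $k$, such that $G^0N$ is open in $G$.
   Context: Commutators: $[x_1,x_2]=x_1^{-1}x_2^{-1}x_1x_2$ and inductively $[x_1,\dots,x_{k+1}]=[[x_1,\dots,x_k],x_{k+1}]$ for $k>1$. For a compact group $G$, $\mathbf{np}_k(G)$ denotes the normalized Haar measure in $G^{k+1}$ of the set $\{(x_1,\dots,x_{k+1})\in G^{k+1} : [x_1,\dots,x_{k+1}]=1\}$. $G^0$ denotes the connected component of the identity of $G$. *)

(* Defs.v *)
From HB Require Import structures.
From mathcomp Require Import all_boot all_order all_algebra all_classical all_reals.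
From mathcomp Require Import ereal topology measure.

Set Implicit Arguments.
Unset Strict Implicit.
Unset Printing Implicit Defensive.

Local Open Scope classical_set_scope.
Local Open Scope group_scope.

HB.mixin Record isTopologicalGroup G & Topological G & Group G := {
  mulg_continuous : continuous (fun x : G * G => x.1 * x.2) ;
  invg_continuous : continuous (fun x : G => x^-1)
}.

(* The distinguished point carries no content for a group; the library merely
   asks for one in order to put a sigma-algebra on a type. *)
#[short(type="topologicalGroupType")]
HB.structure Definition TopologicalGroup :=
  {G of PointedTopological G & Group G & isTopologicalGroup G}.

Section product_group.
Context {I : eqType} (T : I -> topologicalGroupType).

Let mul (f g : prod_topology T) : prod_topology T := fun i => f i * g i.
Let one : prod_topology T := fun=> 1.
Let inv (f : prod_topology T) : prod_topology T := fun i => (f i)^-1.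

Let mulA : associative mul.
Proof. by move=> f g h; apply: functional_extensionality_dep => i; exact: mulgA. Qed.

Let mul1 : left_id one mul.
Proof. by move=> f; apply: functional_extensionality_dep => i; exact: mul1g. Qed.

Let mulr1 : right_id one mul.
Proof. by move=> f; apply: functional_extensionality_dep => i; exact: mulg1. Qed.

Let mulV : left_inverse one inv mul.
Proof. by move=> f; apply: functional_extensionality_dep => i; exact: mulVg. Qed.

Let mulrV : right_inverse one inv mul.
Proof. by move=> f; apply: functional_extensionality_dep => i; exact: mulgV. Qed.

HB.instance Definition _ :=
  isGroup.Build (prod_topology T) mulA mul1 mulr1 mulV mulrV.

HB.instance Definition _ := isPointed.Build (prod_topology T) one.

Let proj_cont i : continuous (fun f : prod_topology T => f i).
Proof.
exact: (@proj_continuous I T i).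
Qed.

Let prod_cont (X : topologicalType) (F : X -> prod_topology T) :
  (forall i, continuous (fun x => F x i)) -> continuous F.
Proof.
move=> cF x; apply/cvg_sup => i.
exact: (@continuous_comp_initial _ _ _ (fun f : forall i, T i => f i) F (cF i)).
Qed.

Let mul_cont :
  continuous (fun x : prod_topology T * prod_topology T => x.1 * x.2).
Proof.
apply: prod_cont => i x.
apply: (@continuous_comp _ _ _
  (fun x : prod_topology T * prod_topology T => (x.1 i, x.2 i))
  (fun y : T i * T i => y.1 * y.2)); last exact: mulg_continuous.
apply: cvg_pair.
  apply: (continuous_comp (f := fst) (g := fun f : prod_topology T => f i)).
    exact: cvg_fst.
  exact: proj_cont.
apply: (continuous_comp (f := snd) (g := fun f : prod_topology T => f i)).
  exact: cvg_snd.
exact: proj_cont.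
Qed.

Let inv_cont : continuous (fun x : prod_topology T => x^-1).
Proof.
apply: prod_cont => i x.
apply: (continuous_comp (f := fun f : prod_topology T => f i)
                        (g := fun y : T i => y^-1)).
  exact: proj_cont.
exact: invg_continuous.
Qed.

HB.instance Definition _ :=
  isTopologicalGroup.Build (prod_topology T) mul_cont inv_cont.

End product_group.

Definition gpower (G : topologicalGroupType) (n : nat) : topologicalGroupType :=
  {ptws 'I_n -> G}.

Definition borel (T : ptopologicalType) := g_sigma_algebraType (@open T).

(* `G` is meant to be compact Hausdorff.  The regularity clauses are part of
   the definition of a Haar measure: they matter when `G` is not
   second-countable. *)
Definition normalized_haar (R : realType) (G : topologicalGroupType)
    (mu : probability (borel G) R) : Prop :=
  [/\ forall (g : G) (A : set (borel G)), measurable A ->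
        mu [set g * x | x in (A : set G)] = mu A,
      forall A : set (borel G), measurable A ->
        mu A = ereal_inf [set mu U | U in [set U : set G | open U /\ A `<=` U]]
    & forall U : set G, open U ->
        mu U = ereal_sup [set mu K | K in [set K : set G | compact K /\ K `<=` U]]].

Definition lcommg (G : groupType) (k : nat) (x : 'I_k.+1 -> G) : G :=
  foldl (@commg G) (x ord0) [seq x (lift ord0 i) | i <- enum 'I_k].

(* The Haar measure `mu` of `G ^ k.+1` is a parameter.  The measure is taken on
   the Borel sets of the product space, which for large `G` are more than the
   sets in the product of the Borel sigma-algebras. *)
Definition np (R : realType) (G : topologicalGroupType) (k : nat)
    (mu : probability (borel (gpower G k.+1)) R) : \bar R :=
  mu [set x : gpower G k.+1 | lcommg x = 1].
Arguments np {R} G k mu.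

Definition identity_component (G : topologicalGroupType) : set G :=
  connected_component [set: G] 1.
Arguments identity_component : clear implicits.

Section subgroups.
Context (G : groupType).
Implicit Types A B N : set G.

Definition subgroup A : Prop := group_closed (mem A).

Definition normal_subgroup N : Prop :=
  subgroup N /\ forall g x, N x -> N (x ^ g).

Definition commutator_subgroup A B : set G :=
  smallest subgroup [set [~ a, b] | a in A & b in B].

(* Indexed from 0: `lower_central N 0 = N`. *)
Fixpoint lower_central N (n : nat) : set G :=
  if n is m.+1 then commutator_subgroup (lower_central N m) N else N.

Definition nilpotent_class_le N (k : nat) : Prop :=
  lower_central N k = [set 1].

End subgroups.

(* Main.v *)
Require Import Defs.
From HB Require Import structures.
From mathcomp Require Import all_boot all_order all_algebra all_classical all_reals.
From mathcomp Require Import ereal topology normedtype measure.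
From mathcomp Require Import lebesgue_stieltjes_measure measurable_realfun.
From mathcomp Require Import lebesgue_integral.
From mathcomp Require Import ring lra zify.

(** The subgroup [N] obtained below is itself open, so that [G^0] is contained
    in it.

    Nilpotency. Suppose that [[x_0, ..., x_(j+1)]] falls into a closed normal
    subgroup [Z] for a set of tuples of positive measure. Given the first
    entries, with commutator [c = [x_0, ..., x_j]], the last entry ranges over
    the subgroup [H = {g | [c, g] \in Z}]. A subgroup of large index has many
    disjoint translates, hence the index of [H] is bounded on some set of
    positive measure. Where the index is as large as possible, [H] is locally
    constant: by compactness, a small change of the entries cannot remove an
    element from [H] without raising the index ([max_index_locally_constant]).
    Hence one open subgroup [C], which may be taken normal, is contained in [H]
    for a set of tuples of positive measure ([positive_mass_open_fibre]). In
    other words, [[x_0, ..., x_j]] falls with positive probability into the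
    closed normal subgroup [Z'] of the elements that commute with [C] modulo
    [Z]. Starting from [Z = 1] and [j + 1 = k], this gives an ascending chain of
    closed normal subgroups, the last of which has positive measure and so is
    open; its intersection with the subgroups [C] is [N], and the chain induces
    a central series of [N] ([virtually_nilpotent_mod]). The measure lives on
    the Borel sets of the power [G^(k+1)], which may be more than the product
    sigma-algebra; instead of Fubini's theorem the argument compares densities
    on small neighbourhoods and uses the inner regularity of the measure
    ([density_le]).

    The identity component. [A = G^0] lies in [N], so it is a connected
    nilpotent group. If it is not abelian, let [D = [L, A]] be the last
    nontrivial term of its lower central series; it is central in [A]. For [a] in
    [A] close to [1], the commutators [[y, a]] with [y] in [L] form a subgroup,
    which is close to [1] by compactness of [G]. If [G] had no small subgroups,
    this subgroup would be trivial, so that the centralizer of [L] in [A] would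
    be open, hence all of [A], contrary to [D <> 1]. In general [G] has small
    subgroups, but every [z <> 1] lies outside some subgroup [K] that contains
    all small subgroups centralizing [z] ([small_subgroups_mod]). Applied to a
    commutator [z = [y0, a0]] in [D], the same argument shows that [K] contains
    [[L, A]], although it does not contain [z].

    The subgroup [K] consists of the translations that fix a certain space [V]
    of continuous functions, as in the Peter-Weyl theorem. [V] is an eigenspace
    of an integral operator that commutes with translations by the centralizer
    of [z] and kills all [z]-invariant functions. The unit ball of [V] is
    equicontinuous, so translations [s] by elements close to [1] satisfy
    [|s - 1| <= 1/2] on [V]; and if this holds for a whole group of
    translations, the identity [2 (s - 1) = (s^2 - 1) - (s - 1)^2] forces
    [s = 1] on [V] ([nearly_invariant]). A nonzero eigenfunction is a column of the
    limit of the powers of the kernel, suitably normalized ([top_eigenfunction]). *)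

Set Implicit Arguments.
Unset Strict Implicit.
Unset Printing Implicit Defensive.

Import Order.TTheory GRing.Theory Num.Theory.
Import numFieldNormedType.Exports.
Local Open Scope classical_set_scope.
Local Open Scope group_scope.

(** * Subgroups and commutators *)

Section subgroup_theory.
Context (G : groupType).
Implicit Types (A B S : set G).

Lemma subgroupP S :
  subgroup S <-> S 1 /\ (forall x y, S x -> S y -> S (x * y^-1)).
Proof.
split=> -[S1 SB]; split.
- by move: S1; rewrite inE.
- by move=> x y Sx Sy; have := SB x y; rewrite !inE; apply.
- by rewrite inE.
- by move=> x y; rewrite !inE => Sx Sy; exact: SB.
Qed.

Lemma subgroup1 S : subgroup S -> S 1.
Proof. by case/subgroupP. Qed.

Lemma subgroupV S x : subgroup S -> S x -> S x^-1.
Proof. by case/subgroupP=> S1 SB Sx; rewrite -[x^-1]mul1g; exact: SB. Qed.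

Lemma subgroupM S x y : subgroup S -> S x -> S y -> S (x * y).
Proof.
move=> gS Sx Sy; case/subgroupP: (gS) => _ SB.
by rewrite -[y]invgK; apply: SB => //; exact: subgroupV.
Qed.

Lemma subgroupI A B : subgroup A -> subgroup B -> subgroup (A `&` B).
Proof.
move=> /subgroupP[A1 AB] /subgroupP[B1 BB]; apply/subgroupP; split=> // x y.
by move=> -[Ax Bx] [Ay By]; split; [exact: AB | exact: BB].
Qed.

Lemma normal_subgroupI A B :
  normal_subgroup A -> normal_subgroup B -> normal_subgroup (A `&` B).
Proof.
move=> [gA nA] [gB nB]; split; first exact: subgroupI.
by move=> g x [Ax Bx]; split; [exact: nA | exact: nB].
Qed.

Lemma normal_subgroup1 : normal_subgroup [set (1 : G)].
Proof.
split; last by move=> g x ->; rewrite /= conj1g.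
by apply/subgroupP; split=> // x y -> ->; rewrite /= mulgV.
Qed.

Lemma commMgJ (x y z : G) : [~ x * y, z] = [~ x, z] ^ y * [~ y, z].
Proof. by rewrite /commg /conjg !invgM !mulgA !mulgK. Qed.

Lemma commgMJ (x y z : G) : [~ x, y * z] = [~ x, z] * [~ x, y] ^ z.
Proof. by rewrite /commg /conjg !invgM !mulgA !mulgK. Qed.

Lemma subgroup_comm A B : subgroup (commutator_subgroup A B).
Proof.
apply/subgroupP; split=> [S [/subgroupP[]//]|x y Sx Sy S [gS AS]].
case/subgroupP: (gS) => _; apply; [exact: Sx | exact: Sy].
Qed.

Lemma mem_comm A B a b : A a -> B b -> commutator_subgroup A B [~ a, b].
Proof. by move=> Aa Bb S [_]; apply; exists a => //; exists b. Qed.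

Lemma comm_sub A B S : subgroup S ->
  (forall a b, A a -> B b -> S [~ a, b]) -> commutator_subgroup A B `<=` S.
Proof.
by move=> gS AB x; apply; split=> // _ [a Aa [b Bb <-]]; exact: AB.
Qed.

Lemma comm_mono A B A' B' : A `<=` A' -> B `<=` B' ->
  commutator_subgroup A B `<=` commutator_subgroup A' B'.
Proof.
move=> AA BB; apply: comm_sub; first exact: subgroup_comm.
by move=> a b Aa Bb; apply: mem_comm; [exact: AA | exact: BB].
Qed.

Lemma subgroup_lower_central A n : subgroup A -> subgroup (lower_central A n).
Proof. by move=> gA; case: n => //= n; exact: subgroup_comm. Qed.

Lemma lower_central_mono A B n : A `<=` B ->
  lower_central A n `<=` lower_central B n.
Proof. by move=> AB; elim: n => //= n IH; exact: comm_mono. Qed.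

Lemma lower_central_sub A n : subgroup A -> lower_central A n `<=` A.
Proof.
move=> gA; elim: n => //= n IH; apply: comm_sub => // a b /IH Aa Ab.
have Ai x : A x -> A x^-1 by exact: subgroupV.
rewrite /commg /conjg; do ![apply: subgroupM => //]; exact: Ai.
Qed.

Lemma lower_central_eq1 A n : subgroup A ->
  lower_central A n `<=` [set 1] -> lower_central A n = [set 1].
Proof.
move=> gA h; apply/seteqP; split=> // _ ->.
by apply: subgroup1; exact: subgroup_lower_central.
Qed.

(** Subgroups of infinite index occur, so the index is not a number: it is
    only compared with natural numbers. *)
Definition index_ge S n :=
  exists t : 'I_n -> G, forall i j, i != j -> ~ S ((t i)^-1 * t j).

(** Otherwise [g] could be added to the family [t]. *)
Lemma index_ge_cover S n (t : 'I_n -> G) : subgroup S ->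
  (forall i j, i != j -> ~ S ((t i)^-1 * t j)) -> ~ index_ge S n.+1 ->
  forall g, exists i, S ((t i)^-1 * g).
Proof.
move=> gS tS nS g; apply: contrapT => noi; apply: nS.
have ng i : ~ S ((t i)^-1 * g) by move=> Si; apply: noi; exists i.
exists (fun i => if unlift ord0 i is Some j then t j else g) => i j.
case: (unliftP ord0 i) => [i'|] ->; case: (unliftP ord0 j) => [j'|] -> //.
- by rewrite (inj_eq lift_inj); exact: tS.
- by move=> _ /(subgroupV gS); rewrite invgM invgK; exact: ng.
Qed.

Lemma index_ge_max S n : ~ index_ge S n ->
  exists m, index_ge S m /\ ~ index_ge S m.+1.
Proof.
elim: n => [[]|n IH nSn]; first by exists (fun=> 1) => -[].
by have [/IH|] := pselect (~ index_ge S n) => [//|/contrapT ?]; exists n.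
Qed.

End subgroup_theory.

(** * Compactness and continuity *)

(** The tube lemma. *)
Lemma tube (X T : topologicalType) (K : set T) (x : X) (P : X * T -> Prop) :
  compact K -> (forall t, K t -> \forall p \near (x, t), P p) ->
  \forall x' \near x, forall t, K t -> P (x', t).
Proof.
move=> /compact_near_coveringP cK KP.
apply: (cK X (nbhs x) (fun x' t => P (x', t))) => t /KP.
by case=> -[U V] /= [xU tV] UV; exists (V, U) => //= -[t' x'] /= [? ?]; exact: UV.
Qed.

Lemma near_closedC (X T : topologicalType) (f : X -> T) (F : set T) x :
  closed F -> continuous f -> ~ F (f x) ->
  \forall x' \near x, ~ F (f x').
Proof.
move=> cF cf nF; apply: (cf x (~` F)).
by apply: open_nbhs_nbhs; split=> //; exact: closed_openC.
Qed.

Lemma closed_preimage (X T : topologicalType) (f : X -> T) (F : set T) :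
  closed F -> continuous f -> closed [set x | F (f x)].
Proof. by move=> cF /continuous_closedP; exact. Qed.

Lemma near_nbhsP (X T : topologicalType) (f : X -> T) (U : set T) x :
  nbhs (f x) U -> continuous f -> \forall x' \near x, U (f x').
Proof. by move=> Ux cf; exact: (cf x U). Qed.

Lemma near_openP (X T : topologicalType) (f : X -> T) (U : set T) x :
  open U -> continuous f -> U (f x) -> \forall x' \near x, U (f x').
Proof. by move=> oU cf Ux; apply: (cf x U); exact: open_nbhs_nbhs. Qed.

Section group_continuity.
Context (G : topologicalGroupType) (X : topologicalType).
Implicit Types f g : X -> G.

Lemma continuousMg f g :
  continuous f -> continuous g -> continuous (fun x => f x * g x).
Proof.
move=> cf cg x.
apply: (@continuous_comp _ _ _ (fun x => (f x, g x)) (fun p => p.1 * p.2)).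
  by apply: cvg_pair; [exact: cf | exact: cg].
exact: mulg_continuous.
Qed.

Lemma continuousVg f : continuous f -> continuous (fun x => (f x)^-1).
Proof.
move=> cf x; apply: (@continuous_comp _ _ _ f (fun y : G => y^-1)).
  exact: cf.
exact: invg_continuous.
Qed.

Lemma continuousJg f g :
  continuous f -> continuous g -> continuous (fun x => f x ^ g x).
Proof.
move=> cf cg; rewrite /conjg; apply: continuousMg; first exact: continuousVg.
exact: continuousMg.
Qed.

Lemma continuousRg f g :
  continuous f -> continuous g -> continuous (fun x => [~ f x, g x]).
Proof.
move=> cf cg; rewrite /commg; apply: continuousMg; first exact: continuousVg.
exact: continuousJg.
Qed.

End group_continuity.

Lemma continuous_idfun (X : topologicalType) : continuous (fun x : X => x).
Proof. by move=> x; exact: cvg_id. Qed.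

Lemma continuous_fst (X T : topologicalType) : continuous (@fst X T).
Proof. by move=> x; exact: cvg_fst. Qed.

Lemma continuous_snd (X T : topologicalType) : continuous (@snd X T).
Proof. by move=> x; exact: cvg_snd. Qed.

Lemma continuous_pair (X T Z : topologicalType) (f : X -> T) (g : X -> Z) :
  continuous f -> continuous g -> continuous (fun x => (f x, g x)).
Proof. by move=> cf cg x; apply: cvg_pair; [exact: cf | exact: cg]. Qed.

Lemma continuous_compose (X Y Z : topologicalType) (f : Y -> Z) (g : X -> Y) :
  continuous g -> continuous f -> continuous (fun x => f (g x)).
Proof. by move=> cg cf x; apply: continuous_comp; [exact: cg | exact: cf]. Qed.

Section continuous_real.
Local Open Scope ring_scope.
Context (R : realType) (X : topologicalType).
Implicit Types f g : X -> R.

Lemma continuousDr f g :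
  continuous f -> continuous g -> continuous (fun x => f x + g x).
Proof. by move=> cf cg x; apply: continuousD; [exact: cf | exact: cg]. Qed.

Lemma continuousNr f : continuous f -> continuous (fun x => - f x).
Proof. by move=> cf x; apply: continuousN; exact: cf. Qed.

Lemma continuousMr f g :
  continuous f -> continuous g -> continuous (fun x => f x * g x).
Proof. by move=> cf cg x; apply: continuousM; [exact: cf | exact: cg]. Qed.

Lemma continuousVr f :
  (forall x, f x != 0) -> continuous f -> continuous (fun x => (f x)^-1).
Proof. by move=> f0 cf x; apply: continuousV; [exact: f0 | exact: cf]. Qed.

Lemma continuous_near f x e : continuous f -> 0 < e ->
  \forall x' \near x, `|f x' - f x| < e.
Proof.
move=> cf e0; have /cvgrPdist_lt/(_ _ e0) := cf x.
by apply: filterS => x'; rewrite distrC.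
Qed.

Lemma continuousP_real f :
  (forall x e, 0 < e -> \forall x' \near x, `|f x' - f x| <= e) ->
  continuous f.
Proof.
move=> h x; apply/cvgrPdist_le => e e0.
by have := h x e e0; apply: filterS => x'; rewrite distrC.
Qed.

End continuous_real.

(* The syntactic matching comes first because trying the lemmas blindly makes
   unification compare group products with products of real numbers. *)
Ltac continuity := solve [repeat first
  [ match goal with
    | H : (forall x, @continuous_at _ _ x ?f)
      |- forall x, @continuous_at _ _ x ?f => exact: H
    | |- forall x, @continuous_at _ _ x (fun _ => ?c) => exact: cst_continuous
    | |- forall x, @continuous_at _ _ x (fun y => y) => exact: continuous_idfun
    | |- forall x, @continuous_at _ _ x fst => exact: continuous_fst
    | |- forall x, @continuous_at _ _ x snd => exact: continuous_snd
    | |- forall x, @continuous_at _ _ x (fun y => (@?f y, @?g y)) =>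
        apply: continuous_pair
    | |- forall x, @continuous_at _ _ x (fun y => (@?f y * @?g y)%R) =>
        apply: continuousMr
    | |- forall x, @continuous_at _ _ x (fun y => (@?f y + @?g y)%R) =>
        apply: continuousDr
    | |- forall x, @continuous_at _ _ x (fun y => (- @?f y)%R) =>
        apply: continuousNr
    | |- forall x, @continuous_at _ _ x (fun y => (@?f y * @?g y)%g) =>
        apply: continuousMg
    | |- forall x, @continuous_at _ _ x (fun y => ((@?f y)^-1)%g) =>
        apply: continuousVg
    | |- forall x, @continuous_at _ _ x (fun y => (@?f y ^ @?g y)%g) =>
        apply: continuousJg
    | |- forall x, @continuous_at _ _ x (fun y => ([~ @?f y, @?g y])%g) =>
        apply: continuousRg
    | |- forall x, @continuous_at _ _ x (fun y => ?k (@?g y)) =>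
        is_var k; apply: (@continuous_compose _ _ _ k g)
    | |- forall x, @continuous_at _ _ x (fun y => fst (@?g y)) =>
        apply: (@continuous_compose _ _ _ fst g)
    | |- forall x, @continuous_at _ _ x (fun y => snd (@?g y)) =>
        apply: (@continuous_compose _ _ _ snd g)
    end
  | assumption | exact: cst_continuous | exact: continuous_idfun
  | apply: continuousDr | apply: continuousNr | apply: continuousMr
  | apply: continuousMg | apply: continuousVg ]].

(** Induction over finite open covers. *)
Lemma compact_finite_union (T : topologicalType) (K : set T) (Q : set T -> Prop) :
  compact K -> Q set0 -> (forall A B, Q A -> Q B -> Q (A `|` B)) ->
  (forall x, K x -> exists V, [/\ open V, V x & Q V]) ->
  exists2 U, Q U & K `<=` U.
Proof.
move=> /compact_near_coveringP cK Q0 QU QK.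
pose above A := [set B | Q B /\ A `<=` B].
have FF : Filter (filter_from Q above).
  apply: filter_from_filter; first by exists set0.
  move=> A B QA QB; exists (A `|` B); first exact: QU.
  by move=> C [QC ABC]; split; split=> // x ?; apply: ABC; [left|right].
have [x /QK[V [oV Vx QV]]|A QA] := cK _ (filter_from Q above) (fun B x => B x) FF.
  exists (V, above V) => /=; last by move=> [y B] [/= Vy [_]]; exact.
  by split; [exact: open_nbhs_nbhs | exists V].
by move=> /(_ A) AK; exists A => //; apply: AK; split.
Qed.

(** * Closed families of subgroups of a compact group *)

Section topological_group_theory.
Context (G : topologicalGroupType).
Implicit Types (S C N : set G).

Lemma subgroup_open S : subgroup S -> nbhs 1 S -> open S.
Proof.
move=> gS S1; rewrite openE => x Sx; rewrite /interior.
have : \forall y \near x, S (x^-1 * y).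
  by apply: near_nbhsP; [rewrite mulVg | continuity].
apply: filterS => y /= Sy.
by rewrite -[y](mulVKg x); exact: subgroupM.
Qed.

Lemma open_subgroup_closed S : subgroup S -> open S -> closed S.
Proof.
move=> gS oS; rewrite -openC openE => x nSx; rewrite /interior.
have c : continuous (fun y : G => y^-1 * x).
  by continuity.
have : \forall y \near x, S (y^-1 * x).
  by apply: near_openP => //; rewrite mulVg; exact: subgroup1.
apply: filterS => y Sy nSy; apply: nSx.
by rewrite -[x](mulVKg y); exact: subgroupM.
Qed.

Lemma closed_index_open S n :
  subgroup S -> closed S -> ~ index_ge S n -> open S.
Proof.
move=> gS cS /index_ge_max[m [[t tS] mS]].
have cov := index_ge_cover gS tS mS.
have [i0 Si0] := cov 1; rewrite mulg1 in Si0.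
apply: subgroup_open => //.
have : \forall w \near (1 : G), forall i, i != i0 -> ~ S ((t i)^-1 * w).
  apply: filter_forall => i; have [->|ii0] := eqVneq i i0.
    by apply: filterS filterT => w.
  have : \forall w \near (1 : G), ~ S ((t i)^-1 * w).
    apply: near_closedC => //.
      by continuity.
    rewrite mulg1 => Si; apply: (tS _ _ ii0); apply: subgroupM => //.
    by rewrite -[t i0]invgK; exact: subgroupV.
  by apply: filterS => w Hw _; exact: Hw.
apply: filterS => w hw; have [i Si] := cov w.
have [ii0|/hw//] := eqVneq i i0.
rewrite -[w](mulVKg (t i)); apply: subgroupM => //; rewrite ii0.
by rewrite -[t i0]invgK; exact: subgroupV.
Qed.

Section closed_family.
Context (Y : topologicalType) (H : Y -> set G).
Hypothesis H_closed : closed [set p : Y * G | H p.1 p.2].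
Hypothesis H_subgroup : forall y, subgroup (H y).

Lemma index_ge_near n (t : 'I_n -> G) y :
  (forall i j, i != j -> ~ H y ((t i)^-1 * t j)) ->
  \forall y' \near y, forall i j, i != j -> ~ H y' ((t i)^-1 * t j).
Proof.
move=> tH; apply: filter_forall => i; apply: filter_forall => j.
have [->|ij] := eqVneq i j; first by apply: filterS filterT => w.
have : \forall y' \near y, ~ H y' ((t i)^-1 * t j).
  apply: (near_closedC (f := fun y' => (y', (t i)^-1 * t j)) H_closed).
    by continuity.
  exact: tH.
exact: filterS.
Qed.

Lemma open_index_ge n : open [set y | index_ge (H y) n].
Proof.
rewrite openE => y [t /index_ge_near]; rewrite /interior; apply: filterS => y' ?.
by exists t.
Qed.

Lemma fibre_compact : compact [set: G] -> forall y, compact (H y).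
Proof.
move=> cG y; apply: (subclosed_compact _ cG) => //.
by apply: (closed_preimage (f := fun g => (y, g)) H_closed); continuity.
Qed.

(** Let [t] represent the [n] cosets of [H y]. For [y'] near [y] the [t i] are
    still in different cosets of [H y'], and they exhaust these cosets if the
    index does not exceed [n]. By compactness of [H y], all its elements stay
    outside all these cosets but one, which is therefore the coset of [1]. *)
Lemma max_index_locally_constant n y : compact [set: G] ->
  index_ge (H y) n -> ~ index_ge (H y) n.+1 ->
  \forall y' \near y, ~ index_ge (H y') n.+1 -> H y `<=` H y'.
Proof.
move=> cG [t tH] nH; have cov := index_ge_cover (H_subgroup y) tH nH.
have [i0 Hi0] := cov 1; rewrite mulg1 in Hi0.
have Hi0' : H y (t i0) by rewrite -[t i0]invgK; exact: subgroupV.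
have : \forall y' \near y, forall i, i != i0 ->
    forall w, H y w -> ~ H y' ((t i)^-1 * w).
  apply: filter_forall => i; have [->|ii0] := eqVneq i i0.
    by apply: filterS filterT => p.
  have : \forall y' \near y, forall w, H y w -> ~ H y' ((t i)^-1 * w).
    apply: (@tube _ _ _ _ (fun p : Y * G => ~ H p.1 ((t i)^-1 * p.2))).
      exact: fibre_compact.
    move=> w Hw.
    apply: (near_closedC (f := fun p => (p.1, (t i)^-1 * p.2)) H_closed).
      by continuity.
    move=> /= Hi; apply: (tH _ _ ii0); apply: subgroupM => //.
    rewrite -[(t i)^-1](mulgK w); apply: subgroupM => //.
    exact: subgroupV.
  by apply: filterS => w Hw _; exact: Hw.
move: (index_ge_near tH); apply: (filterS2 _ (F := nbhs y)) => y' tH' tube_y' nH' w Hw.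
have cov' := index_ge_cover (H_subgroup y') tH' nH'.
have coset v : H y v -> H y' ((t i0)^-1 * v).
  by move=> Hv; have [i Hi] := cov' v; have [<-//|/tube_y' /(_ _ Hv)] := eqVneq i i0.
rewrite -[w](mulVKg (t i0)); apply: subgroupM => //; last exact: coset.
rewrite -[t i0]invgK; apply: subgroupV => //; rewrite -[_^-1]mulg1.
by apply: coset; exact: subgroup1.
Qed.

End closed_family.

Lemma open_normal_core C : compact [set: G] -> subgroup C -> open C ->
  exists C0, [/\ normal_subgroup C0, open C0 & C0 `<=` C].
Proof.
move=> cG gC oC; exists [set g | forall x, C (g ^ x)].
have gC0 : subgroup [set g | forall x, C (g ^ x)].
  apply/subgroupP; split=> [x|g h Cg Ch x]; first by rewrite conj1g; exact: subgroup1.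
  by rewrite conjMg conjVg; apply: subgroupM => //; exact: subgroupV.
split.
- by split=> // g x Cx y; rewrite -conjgM.
- apply: subgroup_open => //.
  have : \forall g \near (1 : G), forall x, [set: G] x -> C (g ^ x).
    apply: (@tube _ _ _ _ (fun p => C (p.1 ^ p.2))) => // x _.
    apply: near_openP => //; last by rewrite conj1g; exact: subgroup1.
    by continuity.
  by apply: filterS => g Cg x; exact: Cg.
- by move=> g /(_ 1); rewrite conjg1.
Qed.

End topological_group_theory.

(** * Sets of positive measure *)

Section mass.
Context (R : realType) (T : ptopologicalType) (mu : probability (borel T) R).
Local Open Scope ring_scope.
Implicit Types A B U : set T.

Definition bmeasurable A := measurable (A : set (borel T)).

Lemma open_bmeasurable U : open U -> bmeasurable U.
Proof. by move=> oU; exact: sub_sigma_algebra. Qed.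

Lemma bmeasurableC A : bmeasurable A -> bmeasurable (~` A).
Proof. exact: measurableC. Qed.

Lemma bmeasurableI A B : bmeasurable A -> bmeasurable B -> bmeasurable (A `&` B).
Proof. exact: measurableI. Qed.

Lemma bmeasurableU A B : bmeasurable A -> bmeasurable B -> bmeasurable (A `|` B).
Proof. exact: measurableU. Qed.

Lemma bmeasurableD A B : bmeasurable A -> bmeasurable B -> bmeasurable (A `\` B).
Proof. exact: measurableD. Qed.

Lemma closed_bmeasurable A : closed A -> bmeasurable A.
Proof.
move=> cA; rewrite -[A]setCK; apply: bmeasurableC; apply: open_bmeasurable.
exact: closed_openC.
Qed.

Definition mass A : R := fine (mu A).

Lemma massE A : bmeasurable A -> mu A = (mass A)%:E.
Proof. by move=> mA; rewrite /mass fineK// fin_num_measure. Qed.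

Lemma mass_ge0 A : 0 <= mass A.
Proof. by rewrite /mass fine_ge0. Qed.

Lemma mass0 : mass set0 = 0.
Proof. by rewrite /mass measure0. Qed.

Lemma massU A B : bmeasurable A -> bmeasurable B -> A `&` B = set0 ->
  mass (A `|` B) = mass A + mass B.
Proof.
move=> mA mB AB; apply: EFin_inj; rewrite EFinD -!massE//.
  exact: measureU.
exact: bmeasurableU.
Qed.

Lemma mass_split A B : bmeasurable A -> bmeasurable B ->
  mass A = mass (A `&` B) + mass (A `\` B).
Proof.
move=> mA mB; rewrite -massU ?setUIDK//; [exact: bmeasurableI|exact: bmeasurableD|].
by apply/seteqP; split=> // x [[_ Bx] [_ ]].
Qed.

Lemma le_mass A B : bmeasurable A -> bmeasurable B -> A `<=` B ->
  mass A <= mass B.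
Proof.
move=> mA mB AB; rewrite -lee_fin -!massE//.
by apply: le_measure => //; exact: mem_set.
Qed.

Lemma mass_le1 A : bmeasurable A -> mass A <= 1.
Proof. by move=> mA; rewrite -lee_fin -massE// probability_le1. Qed.

Lemma packing n (F : 'I_n -> set T) W b : bmeasurable W ->
  (forall i, bmeasurable (F i)) -> (forall i, F i `<=` W) ->
  (forall i j x, F i x -> F j x -> i = j) -> (forall i, mass (F i) = b) ->
  n%:R * b <= mass W.
Proof.
elim: n F W => [|n IH] F W mW mF FW tF Fb.
  by rewrite mul0r mass_ge0.
have := IH (fun i => F (lift ord0 i)) (W `\` F ord0).
rewrite [mass W](mass_split mW (mF ord0)) setIidr// Fb => h.
rewrite -natr1 mulrDl mul1r addrC lerD2l; apply: h => //.
- exact: bmeasurableD.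
- move=> i x Fx; split; first exact: FW Fx.
  by move=> /(tF _ _ _ Fx)/eqP; rewrite eq_sym (negbTE (neq_lift _ _)).
- by move=> i j x Fi Fj; apply: (@lift_inj _ ord0); exact: tF Fi Fj.
Qed.

Hypothesis mu_inner : forall U : set T, open U ->
  mu U = ereal_sup [set mu K | K in [set K : set T | compact K /\ K `<=` U]].
Hypothesis T_hausdorff : hausdorff_space T.

Lemma mass_inner U e : open U -> 0 < e ->
  exists K, [/\ compact K, K `<=` U & mass U - e < mass K].
Proof.
move=> oU e0; have : ((mass U - e)%:E < mu U)%E.
  by rewrite massE ?lte_fin ?ltrBlDr ?ltrDl//; exact: open_bmeasurable.
rewrite (mu_inner oU) => /ereal_sup_gt[_ [K [cK KU] <-]] h; exists K; split=> //.
rewrite -lte_fin -massE//.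
by apply: closed_bmeasurable; exact: compact_closed.
Qed.

(** A bound for the relative measure of [X] in small pieces near every point of
    [E] passes to [E] by cutting a compact subset of [E] into small pieces. This
    takes the place of integrating over [E] first and along the fibres next:
    with [AA] a ring of unions of fibres, the hypothesis on pieces in [AA] is a
    statement about fibres. *)
Lemma density_le (AA : set T -> Prop) (X E : set T) (c : R) :
  (forall A, AA A -> bmeasurable A) ->
  AA set0 -> (forall A B, AA A -> AA B -> AA (A `|` B)) ->
  (forall A B, AA A -> AA B -> AA (A `\` B)) ->
  bmeasurable X -> open E -> 0 <= c ->
  (forall x, E x -> exists V, [/\ open V, V x, AA V &
     forall A, AA A -> A `<=` V -> mass (X `&` A) <= c * mass A]) ->
  mass (X `&` E) <= c.
Proof.
move=> AAm AA0 AAU AAD mX oE c0 loc.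
pose Q U := AA U /\ forall A, AA A -> A `<=` U -> mass (X `&` A) <= c * mass A.
apply/ler_addgt0Pr => e e0.
have [K [cK KE mK]] := mass_inner oE e0.
have [|||U [AAU_ QU] KU] := @compact_finite_union T K Q cK.
- by split=> // A _; rewrite subset0 => ->; rewrite setI0 mass0 mulr0.
- move=> U V [AAu QU] [AAv QV]; split; first exact: AAU.
  move=> A AAA AUV.
  have mA := AAm _ AAA; have mU := AAm _ AAu.
  have AAAU : AA (A `\` U) by exact: AAD.
  have -> : X `&` A = (X `&` (A `\` (A `\` U))) `|` (X `&` (A `\` U)).
    by rewrite -setIUr setDKU//; exact: subDsetl.
  have AAI : AA (A `\` (A `\` U)) by exact: AAD.
  rewrite massU.
  + rewrite (mass_split mA mU) mulrDr; apply: lerD.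
      rewrite -(setDD A U); apply: QU => //; rewrite setDD; exact: subIsetr.
    by apply: QV => // x [/AUV[]].
  + by apply: bmeasurableI => //; exact: AAm.
  + by apply: bmeasurableI => //; exact: AAm.
  + by apply/seteqP; split=> // x [[_ [_ ]]] + [_ Ax]; apply.
- by move=> x /KE/loc[V [oV Vx AAV h]]; exists V.
have mE := open_bmeasurable oE; have mU := AAm _ AAU_.
have mKK : bmeasurable K by apply: closed_bmeasurable; exact: compact_closed.
rewrite (mass_split (bmeasurableI mX mE) mKK).
apply: lerD.
  apply: (@le_trans _ _ (mass (X `&` U))).
    apply: le_mass; [by do 2?apply: bmeasurableI|exact: bmeasurableI|].
    by move=> x [[Xx _] /KU].
  apply: (le_trans (QU U AAU_ (@subset_refl _ _))).
  by rewrite ler_piMr ?mass_le1.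
apply: (@le_trans _ _ (mass (E `\` K))).
  apply: le_mass; [apply: bmeasurableD => //; exact: bmeasurableI|exact: bmeasurableD|].
  by move=> x [[_ Ex] nK].
by move: mK; rewrite (mass_split mE mKK) setIidr//; lra.
Qed.

End mass.

Section power.
Context (G : topologicalGroupType) (n : nat).
Implicit Types (x y : gpower G n) (i j : 'I_n) (g h : G).

Lemma continuous_coord i : continuous (fun x : gpower G n => x i).
Proof. exact: (@proj_continuous 'I_n (fun=> G) i). Qed.

Lemma gpower_mulE x y i : (x * y) i = x i * y i.
Proof. by []. Qed.

Lemma gpower_eqP x y : (forall i, x i = y i) -> x = y.
Proof. by move=> xy; apply: funext. Qed.

Definition slot j g : gpower G n := fun i => if i == j then g else 1.

Lemma slotM j g h : slot j g * slot j h = slot j (g * h).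
Proof.
apply: gpower_eqP => i; rewrite gpower_mulE /slot.
by case: ifP => // _; rewrite mulg1.
Qed.

Lemma slot1 j : slot j 1 = 1.
Proof. by apply: gpower_eqP => i; rewrite /slot if_same. Qed.

Lemma slotKV j g x : slot j g * (slot j g^-1 * x) = x.
Proof. by rewrite mulgA slotM mulgV slot1 mul1g. Qed.

Lemma slotVK j g x : slot j g^-1 * (slot j g * x) = x.
Proof. by rewrite mulgA slotM mulVg slot1 mul1g. Qed.

Hypothesis G_hausdorff : hausdorff_space G.

Lemma gpower_hausdorff : hausdorff_space (gpower G n).
Proof. exact: (@hausdorff_product 'I_n (fun=> G)). Qed.

End power.

Section haar.
Context (R : realType) (G : topologicalGroupType) (n : nat).
Context (mu : probability (borel (gpower G n)) R).
Hypothesis mu_haar : normalized_haar mu.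
Hypothesis G_compact : compact [set: G].
Hypothesis G_hausdorff : hausdorff_space G.
Local Open Scope ring_scope.

Local Notation mass := (mass mu).

Lemma bmeasurable_translate (g : gpower G n) A :
  bmeasurable A -> bmeasurable [set (g * x)%g | x in A].
Proof.
move=> mA; have -> : [set (g * x)%g | x in A] = (fun x => (g^-1 * x)%g) @^-1` A.
  apply/seteqP; split=> [_ [x Ax <-]|x /= Ax]; first by rewrite /= mulKg.
  by exists (g^-1 * x)%g => //; rewrite mulVKg.
have c : continuous (fun x : gpower G n => (g^-1 * x)%g) by continuity.
pose f (x : borel (gpower G n)) : borel (gpower G n) := (g^-1 * x)%g.
have mf : measurable_fun setT f.
  apply: (@measurability _ _ (borel (gpower G n)) (borel (gpower G n))
            setT _ (@open (gpower G n))) => // _ [U oU <-].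
  by rewrite setTI; apply: sub_sigma_algebra; move/continuousP: c; exact.
by rewrite -[X in bmeasurable X]setTI; exact: mf.
Qed.

Lemma mass_translate (g : gpower G n) A :
  bmeasurable A -> mass [set (g * x)%g | x in A] = mass A.
Proof. by move=> mA; case: mu_haar => inv _ _; exact: (congr1 fine (inv g A mA)). Qed.

Let inner : forall U : set (gpower G n), open U ->
  mu U = ereal_sup [set mu K | K in [set K : set (gpower G n) | compact K /\ K `<=` U]].
Proof. by case: mu_haar. Qed.

Section fibres.
Context (H : gpower G n -> set G) (j : 'I_n).
Hypothesis H_closed : closed [set p : gpower G n * G | H p.1 p.2].
Hypothesis H_subgroup : forall x, subgroup (H x).
Hypothesis H_slot : forall g x, H (slot j g * x)%g = H x.

Let X := [set x : gpower G n | H x (x j)].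

Let E N := [set x : gpower G n | index_ge (H x) N].

Let E_open N : open (E N).
Proof. exact: open_index_ge. Qed.

Let X_closed : closed X.
Proof.
apply: (closed_preimage (f := fun x : gpower G n => (x, x j)) H_closed).
by apply: continuous_pair; [exact: continuous_idfun | exact: continuous_coord].
Qed.

Let X_measurable : bmeasurable X.
Proof. exact: closed_bmeasurable. Qed.

(* The [N] translates of [X] by coset representatives, placed in coordinate [j],
   are disjoint. *)
Let index_density N : (0 < N)%N -> mass (X `&` E N) <= N%:R^-1.
Proof.
move=> N0.
pose AA (A : set (gpower G n)) :=
  bmeasurable A /\ forall g x, A (slot j g * x)%g <-> A x.
have AAD A B : AA A -> AA B -> AA (A `\` B).
  move=> [mA iA] [mB iB]; split; first exact: bmeasurableD.
  by move=> g x; split=> -[/iA Ax nB]; split=> // /iB.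
apply: (density_le inner (gpower_hausdorff G_hausdorff) (AA := AA)).
- by move=> A [].
- by split; [exact: (open_bmeasurable open0) | move=> g x; split].
- move=> A B [mA iA] [mB iB]; split; first exact: bmeasurableU.
  by move=> g x; split=> -[/iA|/iB]; [left|right|left|right].
- exact: AAD.
- exact: X_measurable.
- exact: E_open.
- by rewrite invr_ge0 ler0n.
move=> x [t tH].
pose V := [set y : gpower G n |
  forall i l, i != l -> ~ H y ((t i)^-1 * t l)%g].
have oV : open V.
  by rewrite openE => y Vy; exact: (index_ge_near H_closed).
exists V; split=> //.
  split; first exact: open_bmeasurable.
  by move=> g y; rewrite /V /= H_slot.
move=> A [mA iA] AV.
have mXA : bmeasurable (X `&` A) by exact: bmeasurableI.
have N0' : 0 < N%:R :> R by rewrite ltr0n.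
rewrite ler_pdivlMl//.
apply: (@packing _ _ _ _ (fun i => [set (slot j (t i) * y)%g | y in X `&` A])) => //.
- by move=> i; exact: bmeasurable_translate.
- by move=> i _ [y [_ Ay] <-]; exact/iA.
- move=> i l _ [y [Xy Ay] <-] [z [Xz Az] zy].
  apply: contrapT => /eqP il.
  have zE : z = (slot j ((t l)^-1 * t i) * y)%g.
    by rewrite -slotM -mulgA -zy slotVK.
  have Hzy : H z = H y by rewrite zE H_slot.
  apply: (AV _ Ay l i); first by rewrite eq_sym.
  have -> : ((t l)^-1 * t i)%g = (z j * (y j)^-1)%g.
    by rewrite zE gpower_mulE /slot eqxx mulgK.
  have /subgroupP[_ B] := H_subgroup y.
  by apply: B => //; rewrite -Hzy.
- by move=> i; rewrite mass_translate.
Qed.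

(** [X] is the union of its fibres in direction [j], and [H x] is the fibre
    through [x]. As [X] has positive measure, the fibres of index at most some [N]
    make up a set of positive measure; for the least such [N], almost all of
    this set has index exactly [N], where [max_index_locally_constant]
    applies. *)
Lemma positive_mass_open_fibre : 0 < mass X ->
  exists C, [/\ normal_subgroup C, open C & 0 < mass [set x | C `<=` H x]].
Proof.
move=> X0.
have mE N : bmeasurable (E N) by exact: open_bmeasurable.
have mEC N : bmeasurable (~` E N) by exact: bmeasurableC.
have ex : exists N, `[< 0 < mass (~` E N.+1) >].
  have [N hN] : exists N, N.+1%:R^-1 < mass X.
    exists (Num.bound (mass X)^-1).
    rewrite -[ltRHS]invrK ltf_pV2 ?posrE ?invr_gt0 ?ltr0n//.
    apply: (lt_trans (archi_boundP _)); first by rewrite invr_ge0 mass_ge0.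
    by rewrite ltr_nat.
  exists N; apply/asboolP.
  have XE := index_density (ltn0Sn N).
  have XC := le_mass mu (bmeasurableD X_measurable (mE N.+1)) (mEC N.+1)
    (@subIsetr _ _ _).
  move: hN; rewrite (mass_split mu X_measurable (mE N.+1)).
  by move=> /lt_le_trans/(_ (lerD XE XC)); rewrite ltrDl.
case: (ex_minnP ex) => N /asboolP N0 minN.
have EN0 : mass (~` E N) = 0.
  case: N minN {N0} => [_|N minN].
    suff -> : ~` E 0 = set0 by exact: mass0.
    by rewrite -subset0 => x; apply; exists (fun=> 1%g) => -[].
  apply/eqP; rewrite eq_le mass_ge0 andbT leNgt; apply/negP => /asboolP/minN.
  by rewrite ltnn.
(* [E N] has full measure, so the set [~` E N.+1] of points of index at most [N]
   would be negligible if its points of index [N] had negligible neighbourhoods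
   in it. *)
have [x [U [oU Ux nEx UE mU]]] : exists x U, [/\ open U, U x, ~ E N.+1 x,
   (forall y, U y -> ~ E N.+1 y -> H x `<=` H y) & 0 < mass (U `&` ~` E N.+1)].
  apply: contrapT => no.
  suff : mass (~` E N.+1 `&` E N) <= 0.
    have := mass_split mu (mEC N.+1) (mE N).
    have := le_mass mu (bmeasurableD (mEC N.+1) (mE N)) (mEC N) (@subIsetr _ _ _).
    by lra.
  apply: (density_le inner (gpower_hausdorff G_hausdorff) (AA := @bmeasurable _)) => //.
  - exact: (open_bmeasurable open0).
  - exact: bmeasurableU.
  - exact: bmeasurableD.
  move=> x Ex; have [Ex1|nEx1] := pselect (E N.+1 x).
    exists (E N.+1); split=> // A _ AE; rewrite mul0r.
    suff -> : ~` E N.+1 `&` A = set0 by rewrite mass0.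
    by rewrite -subset0 => y [nE /AE].
  have : nbhs x [set y | ~ E N.+1 y -> H x `<=` H y].
    exact: (max_index_locally_constant H_closed H_subgroup G_compact Ex nEx1).
  rewrite nbhsE => -[U [oU Ux] UE].
  exists U; split=> //; first exact: open_bmeasurable.
  move=> A mA AU; rewrite mul0r leNgt; apply/negP => A0; apply: no.
  exists x, U; split=> //; apply: (lt_le_trans A0).
  apply: le_mass; first exact: bmeasurableI.
    by apply: bmeasurableI => //; exact: open_bmeasurable.
  by move=> y [? /AU].
have oH : open (H x).
  apply: closed_index_open nEx => //.
  apply: (closed_preimage (f := fun g => (x, g)) H_closed).
  by apply: continuous_pair; [exact: cst_continuous | exact: continuous_idfun].
have [C [nC oC CH]] := open_normal_core G_compact (H_subgroup x) oH.
exists C; split=> //; apply: (lt_le_trans mU).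
apply: le_mass.
- by apply: bmeasurableI => //; exact: open_bmeasurable.
- apply: closed_bmeasurable.
  have -> : [set x | C `<=` H x] = \bigcap_(g in C) [set x | H x g].
    by apply/seteqP; split=> y Cy g Cg; exact: Cy.
  apply: closed_bigI => g _.
  apply: (closed_preimage (f := fun y => (y, g)) H_closed).
  by apply: continuous_pair; [exact: continuous_idfun | exact: cst_continuous].
- by move=> y [Uy nEy] g /CH; exact: UE.
Qed.

End fibres.
End haar.

(** * Virtual nilpotency *)

Section iterated_commutator.
Context (G : groupType) (k : nat).
Implicit Types x y : 'I_k.+1 -> G.

(** Unlike [lcommg], this makes sense for every prefix [[x_0, ..., x_j]] of the
    tuple, as needed for an induction on [j]. *)
Fixpoint prefix_comm x (j : nat) : G :=
  if j is i.+1 then [~ prefix_comm x i, x (inord i.+1)] else x ord0.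

Lemma lcommgE x : lcommg x = prefix_comm x k.
Proof.
rewrite /lcommg; set s := [seq _ | _ <- _].
have ss : size s = k by rewrite size_map size_enum_ord.
suff h j : (j <= k)%N -> foldl (@commg G) (x ord0) (take j s) = prefix_comm x j.
  by rewrite -h// take_oversize ?ss.
elim: j => [_|j IH jk]; first by rewrite take0.
rewrite (take_nth 1) ?ss// -cats1 foldl_cat /= IH ?(ltnW jk)//.
congr ([~ _, _]); rewrite (nth_map (Ordinal jk)) ?size_enum_ord//.
congr x; apply: ord_inj; rewrite lift0 inordK//.
by rewrite nth_enum_ord.
Qed.

Lemma eq_prefix_comm x y j : (j <= k)%N ->
  (forall i : 'I_k.+1, (i <= j)%N -> x i = y i) ->
  prefix_comm x j = prefix_comm y j.
Proof.
elim: j => [_ xy|j IH jk xy] /=; first exact: xy.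
rewrite IH ?(ltnW jk) => // [|i ij]; last by apply: xy; exact: leqW.
by rewrite xy// inordK.
Qed.

End iterated_commutator.

Section virtually_nilpotent.
Context (R : realType) (G : topologicalGroupType) (k : nat).
Context (mu : probability (borel (gpower G k.+1)) R).
Hypothesis mu_haar : normalized_haar mu.
Hypothesis G_compact : compact [set: G].
Hypothesis G_hausdorff : hausdorff_space G.

Lemma continuous_prefix_comm j :
  continuous (fun x : gpower G k.+1 => prefix_comm x j).
Proof.
elim: j => [|j IH]; first exact: continuous_coord.
by apply: (continuousRg IH); exact: continuous_coord.
Qed.

(** The fibres in the last coordinate are cut out by [[c, g] \in Z], with [c] the
    commutator of the previous entries, so an open normal subgroup [C] contained in
    many fibres turns the hypothesis on [Z] into the same hypothesis, one commutator
    shorter, on the centralizer [Z'] of [C] modulo [Z]. Membership of [c] in [Z']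
    is the inclusion of [C] in the fibre. *)
Lemma virtually_nilpotent_mod j (Z : set G) : (j <= k)%N ->
  closed Z -> normal_subgroup Z ->
  (0 < mass mu [set x : gpower G k.+1 | Z (prefix_comm x j)])%R ->
  exists N, [/\ normal_subgroup N, open N & lower_central N j `<=` Z].
Proof.
elim: j Z => [|j IH] Z jk cZ [gZ nZ] mZ.
  have [||||C [[gC nC] oC mC]] :=
    @positive_mass_open_fibre R G k.+1 mu mu_haar G_compact G_hausdorff
      (fun=> Z) ord0.
  - by apply: (closed_preimage (f := snd) cZ); continuity.
  - by [].
  - by [].
  - exact: mZ.
  have [x CZ] : exists x : gpower G k.+1, C `<=` Z.
    apply: contrapT => no; move: mC.
    suff -> : [set x : gpower G k.+1 | C `<=` Z] = set0 by rewrite mass0 ltxx.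
    by rewrite -subset0 => x CZ; apply: no; exists x.
  exists Z; split=> //; apply: subgroup_open => //.
  by apply: filterS CZ _; apply: open_nbhs_nbhs; split=> //; exact: subgroup1.
pose H (x : gpower G k.+1) := [set g | Z [~ prefix_comm x j, g]].
have gH x : subgroup (H x).
  have HV g : H x g -> H x g^-1.
    move=> Hg; have := commgMJ (prefix_comm x j) g g^-1.
    rewrite mulgV commg1 => /esym/mulg1_eq e.
    by rewrite /H /= -[[~ _, _]]invgK e; apply: subgroupV => //; exact: nZ.
  apply/subgroupP; split=> [|g h Hg /HV Hh].
    by rewrite /H /= commg1; exact: subgroup1.
  by rewrite /H /= commgMJ; apply: subgroupM => //; exact: nZ.
have [||||C [[gC nC] oC mC]] :=
  @positive_mass_open_fibre R G k.+1 mu mu_haar G_compact G_hausdorff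
    H (inord j.+1).
- apply: (closed_preimage
    (f := fun p : gpower G k.+1 * G => [~ prefix_comm p.1 j, p.2]) cZ).
  apply: continuousRg; last exact: continuous_snd.
  apply: (continuous_compose (f := fun x : gpower G k.+1 => prefix_comm x j)).
    exact: continuous_fst.
  exact: continuous_prefix_comm.
- exact: gH.
- move=> g x; rewrite /H.
  suff -> : prefix_comm (slot (inord j.+1) g * x) j = prefix_comm x j by [].
  apply: eq_prefix_comm; first exact: ltnW.
  move=> i ij; rewrite gpower_mulE /slot; case: eqP => [iE|_]; last by rewrite mul1g.
  by move: ij; rewrite iE inordK// ltnn.
- exact: mZ.
pose Z' := [set z | forall c, C c -> Z [~ z, c]].
have nZ' : normal_subgroup Z'.
  split.
    have Z'V z : Z' z -> Z' z^-1.
      move=> Zz c Cc; have := commMgJ z z^-1 c.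
      rewrite mulgV comm1g => /esym/mulg1_eq <-.
      by apply: subgroupV => //; apply: nZ; exact: Zz.
    apply/subgroupP; split=> [c _|y z Zy /Z'V Zz c Cc].
      by rewrite comm1g; exact: subgroup1.
    by rewrite commMgJ; apply: subgroupM => //; [apply: nZ; exact: Zy|exact: Zz].
  move=> g z Zz c Cc; rewrite -[c](conjgKV g) -conjRg; apply: nZ; apply: Zz.
  exact: nC.
have cZ' : closed Z'.
  have -> : Z' = \bigcap_(c in C) [set z | Z [~ z, c]].
    by apply/seteqP; split=> z Zz c Cc; exact: Zz.
  by apply: closed_bigI => c _; apply: (closed_preimage cZ); continuity.
have [N [nN oN NZ']] := IH Z' (ltnW jk) cZ' nZ' mC.
exists (N `&` C); split.
- exact: normal_subgroupI.
- exact: openI.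
- rewrite /=; apply: comm_sub => // a b Na [_ Cb].
  by apply: (NZ' a) => //; apply: (lower_central_mono (B := N)) Na => z [].
Qed.

Lemma virtually_nilpotent : (0 < np G k mu)%E ->
  exists N : set G,
    [/\ normal_subgroup N, open N & lower_central N k = [set 1]].
Proof.
move=> np0.
have c1 : closed [set (1 : G)].
  by apply: accessible_closed_set1; exact: hausdorff_accessible.
have [|N [nN oN N1]] :=
  @virtually_nilpotent_mod k [set 1] (leqnn k) c1 (normal_subgroup1 G).
  move: np0; rewrite /np.
  rewrite (_ : [set x | _] =
    [set x : gpower G k.+1 | [set 1] (prefix_comm x k)]); last first.
    by apply/seteqP; split=> x /=; rewrite lcommgE.
  rewrite massE ?lte_fin//; apply: closed_bmeasurable.
  apply: (closed_preimage (f := fun x : gpower G k.+1 => prefix_comm x k) c1).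
  exact: continuous_prefix_comm.
exists N; split=> //; apply: lower_central_eq1 => //; exact: (proj1 nN).
Qed.

End virtually_nilpotent.

Local Close Scope group_scope.
Local Open Scope ring_scope.

(** * The Haar integral of continuous functions *)

Lemma compact_continuous_bounded (R : realType) (T : topologicalType) (f : T -> R) :
  compact [set: T] -> continuous f -> exists2 M, 0 <= M & forall x, `|f x| <= M.
Proof.
move=> cT cf.
pose Q (U : set T) := exists2 M, 0 <= M & forall x, U x -> `|f x| <= M.
have [|A B [M M0 AM] [N N0 BN]|x _|U [M M0 UM] TU] := @compact_finite_union T _ Q cT.
- by exists 0 => // x [].
- exists (M + N); first exact: addr_ge0.
  move=> x [/AM fM|/BN fN]; first by rewrite ler_wpDr.
  by rewrite ler_wpDl.
- have : nbhs x [set y | `|f y - f x| < 1] by exact: continuous_near.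
  rewrite nbhsE => -[V [oV Vx] VM]; exists V; split=> //.
  exists (`|f x| + 1) => [|y /VM /= yx]; first by rewrite addr_ge0.
  by rewrite -[f y](subrK (f x)) addrC (le_trans (ler_normD _ _))// lerD2l ltW.
- by exists M => // x; apply: UM; exact: TU.
Qed.

(** The integral against a probability measure, as a functional on continuous
    functions. *)
Record mean_functional (R : realType) (X : topologicalType)
    (J : (X -> R) -> R) : Prop := MeanFunctional {
  mean1 : J (fun=> 1) = 1;
  meanD : forall f g : X -> R, continuous f -> continuous g ->
    J (fun x => f x + g x) = J f + J g;
  meanZ : forall c (f : X -> R), continuous f -> J (fun x => c * f x) = c * J f;
  le_mean : forall f g : X -> R, continuous f -> continuous g ->
    (forall x, f x <= g x) -> J f <= J g
}.

Definition translation_invariant (R : realType) (G : topologicalGroupType)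
    (J : (G -> R) -> R) :=
  forall s (f : G -> R), continuous f -> J (fun x => f (s * x)%g) = J f.

Section haar_mean.
Context (R : realType) (G : topologicalGroupType) (n : nat).
Context (mu : probability (borel (gpower G n.+1)) R).
Hypothesis mu_haar : normalized_haar mu.
Hypothesis G_compact : compact [set: G].

Let J (f : G -> R) := Rintegral mu setT (fun x : gpower G n.+1 => f (x ord0)).

Lemma continuous_measurable (f : gpower G n.+1 -> R) :
  continuous f -> measurable_fun setT (f : borel (gpower G n.+1) -> R).
Proof.
move=> /continuousP cf.
apply: (measurability _ (RGenOpens.measurableE R)) => // _ [_ [a [b ->] <-]].
rewrite setTI; apply: sub_sigma_algebra; apply: cf; exact: interval_open.
Qed.

Let cJ (f : G -> R) : continuous f -> continuous (fun x : gpower G n.+1 => f (x ord0)).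
Proof. by apply: continuous_compose; exact: continuous_coord. Qed.

Let intJ (f : G -> R) : continuous f ->
  mu.-integrable setT (EFin \o (fun x : gpower G n.+1 => f (x ord0))).
Proof.
move=> cf; apply: measurable_bounded_integrable => //.
- by apply: (le_lt_trans (probability_le1 _ _)) (ltry _); exact: measurableT.
- by apply: continuous_measurable; exact: cJ.
- have [M M0 fM] := compact_continuous_bounded G_compact cf.
  exists M; split; first exact: num_real.
  by move=> x Mx y _ /=; exact: le_trans (fM _) (ltW Mx).
Qed.

Lemma haar_invariant_mean : exists J : (G -> R) -> R,
  mean_functional J /\ translation_invariant J.
Proof.
exists J; split; first split.
- rewrite /J Rintegral_cst// mul1r -[RHS]/(fine 1%E); congr fine.
  exact: probability_setT.
- by move=> f g cf cg; rewrite /J RintegralD//; exact: intJ.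
- by move=> c f cf; rewrite /J RintegralZl//; exact: intJ.
- by move=> f g cf cg fg; rewrite /J le_Rintegral//; exact: intJ.
move=> s f cf; rewrite /J /Rintegral; congr fine.
pose phi (x : borel (gpower G n.+1)) : borel (gpower G n.+1) :=
  (slot ord0 s * x)%g.
have mphi : measurable_fun setT phi.
  apply: (@measurability _ _ (borel (gpower G n.+1)) (borel (gpower G n.+1))
    setT _ (@open (gpower G n.+1))) => // _ [U oU <-].
  rewrite setTI; apply: sub_sigma_algebra.
  have c : continuous (phi : gpower G n.+1 -> gpower G n.+1).
    by rewrite /phi; continuity.
  by move/continuousP: c; exact.
have := @integral_pushforward _ _ _ _ R phi mphi mu setT (fun x => (f (x ord0))%:E).
rewrite preimage_setT => <- //.
- apply: eq_measure_integral => A mA _.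
  case: mu_haar => inv _ _.
  have mA' : bmeasurable (phi @^-1` A).
    by rewrite -[X in bmeasurable X]setTI; exact: mphi.
  have := inv (slot ord0 s) _ mA'; rewrite (_ : [set _ | _ in _] = A) => [e|].
    exact: (esym e).
  apply/seteqP; split=> [_ [x /= Ax <-]//|x Ax].
  by exists (slot ord0 s^-1 * x)%g; rewrite /= ?slotKV// /phi slotKV.
- apply: measurableT_comp => //; apply: continuous_measurable; exact: cJ.
- suff -> : (fun x => (f (x ord0))%:E) \o phi =
      EFin \o (fun x : gpower G n.+1 => f (s * x ord0)%g).
    apply: (@intJ (fun y => f (s * y)%g)).
    by apply: (continuous_compose (f := f)) => //; continuity.
  by apply: funext => x; rewrite /phi /= gpower_mulE /slot eqxx.
Qed.

End haar_mean.

Section mean_theory.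
Context (R : realType) (X : topologicalType) (J : (X -> R) -> R).
Hypothesis mJ : mean_functional J.
Implicit Types f g : X -> R.

Lemma mean_cst c : J (fun=> c) = c.
Proof.
have -> : (fun=> c) = (fun x : X => c * 1) by apply: funext => x; rewrite mulr1.
by rewrite (meanZ mJ) ?(mean1 mJ) ?mulr1//; continuity.
Qed.

Lemma meanN f : continuous f -> J (fun x => - f x) = - J f.
Proof.
move=> cf; have -> : (fun x => - f x) = (fun x => -1 * f x).
  by apply: funext => x; rewrite mulN1r.
by rewrite (meanZ mJ)// mulN1r.
Qed.

Lemma meanB f g : continuous f -> continuous g ->
  J (fun x => f x - g x) = J f - J g.
Proof. by move=> cf cg; rewrite (meanD mJ)// ?meanN//; continuity. Qed.

Lemma mean_ge0 f : continuous f -> (forall x, 0 <= f x) -> 0 <= J f.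
Proof.
move=> cf f0; rewrite -[leLHS]mean_cst.
by apply: (le_mean mJ) => //; continuity.
Qed.

Lemma mean_le f M : continuous f -> (forall x, f x <= M) -> J f <= M.
Proof.
move=> cf fM; rewrite -[leRHS]mean_cst.
by apply: (le_mean mJ) => //; continuity.
Qed.

Lemma normr_mean f M : continuous f -> (forall x, `|f x| <= M) -> `|J f| <= M.
Proof.
move=> cf fM; rewrite ler_norml lerNl -meanN//; apply/andP; split.
  apply: mean_le => [|x]; first by continuity.
  by rewrite (le_trans _ (fM x))// -normrN ler_norm.
by apply: mean_le => // x; rewrite (le_trans (ler_norm _)).
Qed.

Lemma mean_dist f g e : continuous f -> continuous g ->
  (forall x, `|f x - g x| <= e) -> `|J f - J g| <= e.
Proof. by move=> cf cg fg; rewrite -meanB//; apply: normr_mean => //; continuity. Qed.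

Lemma mean_cauchy_schwarz f g : continuous f -> continuous g ->
  J (fun x => f x * g x) ^+ 2 <= J (fun x => f x * f x) * J (fun x => g x * g x).
Proof.
move=> cf cg; set b := J _; set a := J _; set c := J _.
have h s : 0 <= a - 2 * s * b + s * s * c.
  have -> : a - 2 * s * b + s * s * c =
      J (fun x => (f x - s * g x) * (f x - s * g x)).
    have -> : (fun x => (f x - s * g x) * (f x - s * g x)) =
        (fun x => (f x * f x + (- (2 * s)) * (f x * g x)) + (s * s) * (g x * g x)).
      by apply: funext => x; ring.
    rewrite (meanD mJ) ?(meanD mJ) ?(meanZ mJ) -/a -/b -/c; try continuity.
    by rewrite mulNr.
  by apply: mean_ge0 => [|x]; [continuity | rewrite -expr2 sqr_ge0].
have c0 : 0 <= c by apply: mean_ge0 => [|x]; [continuity | rewrite -expr2 sqr_ge0].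
move: c0; rewrite le0r => /predU1P[c0|c0]; last first.
  have := h (b / c); rewrite -(ler_pM2r c0) mul0r.
  rewrite (_ : (_ + _) * c = a * c - b ^+ 2); first by rewrite subr_ge0.
  by field; rewrite gt_eqF.
have [->|b0] := eqVneq b 0; first by rewrite expr0n c0 mulr0.
have := h ((a + 1) / (2 * b)); rewrite c0 mulr0 addr0.
rewrite (_ : _ - _ = -1); last by field.
by rewrite oppr_ge0 ler10.
Qed.

End mean_theory.

Lemma continuous_near_uniform (R : realType) (T X : topologicalType)
    (F : T * X -> R) t e :
  compact [set: X] -> continuous F -> 0 < e ->
  \forall t' \near t, forall x, `|F (t', x) - F (t, x)| < e.
Proof.
move=> cX cF e0.
have : \forall t' \near t, forall x, [set: X] x -> `|F (t', x) - F (t, x)| < e.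
  apply: (@tube _ _ _ _ (fun p => `|F p - F (t, p.2)| < e)) => // x _.
  pose D p := F p - F (t, p.2).
  have : \forall p \near (t, x), `|D p - D (t, x)| < e.
    by apply: continuous_near => //; rewrite /D; continuity.
  by rewrite /D subrr; apply: filterS => p; rewrite subr0.
by apply: filterS => t' h x; exact: h.
Qed.

Section mean_parameter.
Context (R : realType) (X T : topologicalType) (J : (X -> R) -> R).
Hypothesis mJ : mean_functional J.
Hypothesis X_compact : compact [set: X].

Lemma continuous_mean (F : T * X -> R) :
  continuous F -> continuous (fun t => J (fun x => F (t, x))).
Proof.
move=> cF; apply: continuousP_real => t e e0.
have := @continuous_near_uniform _ _ _ F t e X_compact cF e0.
apply: filterS => t' h; apply: (mean_dist mJ) => [||x]; [continuity|continuity|].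
by apply/ltW/h.
Qed.

End mean_parameter.

Section group_mean.
Context (R : realType) (G : topologicalGroupType) (J : (G -> R) -> R).
Hypothesis mJ : mean_functional J.
Hypothesis J_inv : translation_invariant J.
Hypothesis G_compact : compact [set: G].
Hypothesis G_hausdorff : hausdorff_space G.

(** If [f] were not zero, finitely many translates of it would have a sum bounded
    below by a positive constant. *)
Lemma mean_eq0 (f : G -> R) :
  continuous f -> (forall x, 0 <= f x) -> J f = 0 -> forall x, f x = 0.
Proof.
move=> cf f0 Jf x0; apply: contrapT => /eqP fx0.
have fx0_gt0 : 0 < f x0 by rewrite lt0r fx0 f0.
pose Q (U : set G) := exists (F : G -> R) c,
  [/\ continuous F, forall x, 0 <= F x, J F = 0, 0 < c & forall x, U x -> c <= F x].
have [|A B|x _|U [F [c [cF F0 JF c0 cFU]]] TU] :=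
  @compact_finite_union G _ Q G_compact.
- by exists (fun=> 0), 1; split=> //; [continuity | exact: mean_cst].
- move=> [F [c [cF F0 JF c0 AF]]] [F' [c' [cF' F0' JF' c0' BF']]].
  exists (fun x => F x + F' x), (Num.min c c'); split.
  + by continuity.
  + by move=> x; exact: addr_ge0.
  + by rewrite (meanD mJ)// JF JF' addr0.
  + by rewrite lt_min c0.
  + move=> x [/AF|/BF'] h; rewrite ge_min.
      by rewrite (le_trans h)// ler_wpDr.
    by rewrite (le_trans h) ?orbT// ler_wpDl.
- pose F y := f (x0 * x^-1 * y)%g.
  have cF : continuous F by rewrite /F; continuity.
  have : nbhs x [set y | `|F y - F x| < f x0 / 2].
    by apply: continuous_near => //; rewrite divr_gt0.
  rewrite nbhsE => -[V [oV Vx] VF]; exists V; split=> //.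
  exists F, (f x0 / 2); split=> //.
  + by move=> y; exact: f0.
  + by rewrite /F J_inv.
  + by rewrite divr_gt0.
  + move=> y /VF /=; rewrite {2}/F mulgVK ltr_norml; lra.
have : c <= J F.
  rewrite -[leLHS](mean_cst mJ); apply: (le_mean mJ) => // [|x]; last exact/cFU/TU.
  by continuity.
by rewrite JF leNgt c0.
Qed.

Lemma bump_function (x0 : G) (U : set G) : nbhs x0 U -> exists b : G -> R,
  [/\ continuous b, forall x, 0 <= b x, b x0 = 1 & forall x, ~ U x -> b x = 0].
Proof.
rewrite nbhsE => -[V [oV Vx0] VU].
have /(normal_separatorP (R := R)) sep := compact_normal G_hausdorff G_compact.
have us : uniform_separator (~` V) [set x0].
  apply: sep; first exact: open_closedC.
    by apply: accessible_closed_set1; exact: hausdorff_accessible.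
  by rewrite -subset0 => x [nV /= xx0]; apply: nV; rewrite xx0.
exists (Urysohn (R := R) (~` V) [set x0]); split.
- exact: Urysohn_continuous.
- move=> x; have := @Urysohn_range _ R (~` V) [set x0] (Urysohn (~` V) [set x0] x).
  by move=> /(_ (ex_intro2 _ _ x I erefl)); rewrite /= in_itv /= => /andP[].
- by apply: (Urysohn_sub1 us); exists x0.
- by move=> x nU; apply: (Urysohn_sub0 us); exists x => // /VU.
Qed.

(** Exchanging two integrals is immediate for products [b x * F (x0, y)]. With
    bump functions [b], sums of such products approximate [s x * F (x, y)], where [s]
    is the sum of the bump functions, and [s] is bounded below as soon as the
    bumps cover [G]. *)
Lemma mean_exchange (F : G * G -> R) : continuous F ->
  J (fun x => J (fun y => F (x, y))) = J (fun y => J (fun x => F (x, y))).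
Proof.
move=> cF.
have cJ1 (P : G * G -> R) : continuous P -> continuous (fun x => J (fun y => P (x, y))).
  exact: continuous_mean.
have cJ2 (P : G * G -> R) : continuous P -> continuous (fun y => J (fun x => P (x, y))).
  move=> cP; apply: (continuous_mean mJ G_compact (F := fun p => P (p.2, p.1))).
  by continuity.
suff h (e : R) : 0 < e -> `|J (fun x => J (fun y => F (x, y)))
    - J (fun y => J (fun x => F (x, y)))| <= e.
  apply/eqP; rewrite -subr_eq0 -normr_eq0 eq_le normr_ge0 andbT.
  by apply/ler_addgt0Pr => e /h; rewrite add0r.
move=> e0.
pose good (P : G * G -> R) := continuous P /\ forall w : G -> R, continuous w ->
  J (fun x => J (fun y => w x * P (x, y))) = J (fun y => J (fun x => w x * P (x, y))).
have goodP (b : G -> R) x0 : continuous b -> good (fun p => b p.1 * F (x0, p.2)).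
  move=> cb; split; first by continuity.
  move=> w cw /=.
  have -> : (fun x => J (fun y => w x * (b x * F (x0, y)))) =
      (fun x => J (fun y => F (x0, y)) * (w x * b x)).
    apply: funext => x; rewrite mulrC -(meanZ mJ); last by continuity.
    by congr J; apply: funext => y; rewrite mulrA.
  have -> : (fun y => J (fun x => w x * (b x * F (x0, y)))) =
      (fun y => J (fun x => w x * b x) * F (x0, y)).
    apply: funext => y; rewrite mulrC -(meanZ mJ); last by continuity.
    by congr J; apply: funext => x; rewrite mulrA mulrC.
  rewrite (meanZ mJ); last by continuity.
  by rewrite (meanZ mJ) 1?mulrC//; continuity.
have goodD P P' : good P -> good P' -> good (fun p => P p + P' p).
  move=> [cP gP] [cP' gP']; split; first by continuity.
  move=> w cw.
  have cwP : continuous (fun p => w p.1 * P p) by continuity.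
  have cwP' : continuous (fun p => w p.1 * P' p) by continuity.
  have -> : (fun x => J (fun y => w x * (P (x, y) + P' (x, y)))) =
     (fun x => J (fun y => w x * P (x, y)) + J (fun y => w x * P' (x, y))).
    apply: funext => x; rewrite -(meanD mJ); [|continuity|continuity].
    by congr J; apply: funext => y; rewrite mulrDr.
  have -> : (fun y => J (fun x => w x * (P (x, y) + P' (x, y)))) =
     (fun y => J (fun x => w x * P (x, y)) + J (fun x => w x * P' (x, y))).
    apply: funext => y; rewrite -(meanD mJ); [|continuity|continuity].
    by congr J; apply: funext => x; rewrite mulrDr.
  rewrite (meanD mJ) ?gP ?gP'// ?(meanD mJ)//.
  - exact: (cJ2 _ cwP).
  - exact: (cJ2 _ cwP').
  - exact: (cJ1 _ cwP).
  - exact: (cJ1 _ cwP').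
pose Q (U : set G) := exists (s : G -> R) P c,
  [/\ continuous s, (forall x, 0 <= s x), 0 < c, (forall x, U x -> c <= s x)
    & good P /\ forall x y, `|P (x, y) - s x * F (x, y)| <= e / 2 * s x].
have [||x0 _|U [s [P [c [cs s0 c0 sU [[cP gP] PF]]]]] TU] :=
  @compact_finite_union G _ Q G_compact.
- exists (fun=> 0), (fun=> 0), 1; split=> //; first by continuity.
  split; last by move=> x y; rewrite mul0r subr0 normr0 mulr0.
  split; first by continuity.
  move=> w cw /=; congr J; apply: funext => x.
  by congr J; apply: funext => y; rewrite !mulr0.
- move=> A B [s [P [c [cs s0 c0 sA [gP PF]]]]].
  move=> [s' [P' [c' [cs' s0' c0' sB [gP' PF']]]]].
  exists (fun x => s x + s' x), (fun p => P p + P' p), (Num.min c c'); split.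
  + by continuity.
  + by move=> x; exact: addr_ge0.
  + by rewrite lt_min c0.
  + move=> x [/sA|/sB] h; rewrite ge_min.
      by rewrite (le_trans h)// ler_wpDr.
    by rewrite (le_trans h) ?orbT// ler_wpDl.
  + split; first exact: goodD.
    move=> x y; rewrite mulrDl opprD addrACA mulrDr.
    by apply: (le_trans (ler_normD _ _)); exact: lerD.
- have : nbhs x0 [set x | forall y, `|F (x, y) - F (x0, y)| < e / 2].
    by apply: continuous_near_uniform => //; rewrite divr_gt0.
  move=> /bump_function[b [cb b0 bx0 bU]].
  have : nbhs x0 [set x | `|b x - b x0| < 1 / 2].
    by apply: continuous_near => //; rewrite divr_gt0.
  rewrite nbhsE => -[V [oV Vx] Vb]; exists V; split=> //.
  exists b, (fun p => b p.1 * F (x0, p.2)), (1 / 2); split=> //.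
  + by move=> x /Vb /=; rewrite bx0 ltr_norml; lra.
  + split; first exact: goodP.
    move=> x y /=; rewrite -mulrBr normrM ger0_norm// mulrC.
    have [Ux|nUx] := pselect (forall y, `|F (x, y) - F (x0, y)| < e / 2).
      by apply: ler_wpM2r => //; rewrite distrC; apply/ltW/Ux.
    by rewrite (bU _ nUx) !mulr0.
have s_gt0 x : 0 < s x by rewrite (lt_le_trans c0)// sU//; exact: TU.
pose w x := (s x)^-1.
have cw : continuous w by apply: continuousVr => // x; rewrite gt_eqF.
have wP x y : `|F (x, y) - w x * P (x, y)| <= e / 2.
  rewrite -(ler_pM2r (s_gt0 x)) -[X in _ * X <= _](ger0_norm (s0 x)) -normrM.
  rewrite mulrBl /w mulrAC mulVf ?gt_eqF// mul1r distrC mulrC; exact: PF.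
have cwP : continuous (fun p => w p.1 * P p) by continuity.
have h1 : `|J (fun x => J (fun y => F (x, y)))
    - J (fun x => J (fun y => w x * P (x, y)))| <= e / 2.
  apply: (mean_dist mJ) => [||x]; [exact: cJ1|exact: (cJ1 _ cwP)|].
  by apply: (mean_dist mJ) => //; continuity.
have h2 : `|J (fun y => J (fun x => F (x, y)))
    - J (fun y => J (fun x => w x * P (x, y)))| <= e / 2.
  apply: (mean_dist mJ) => [||y]; [exact: cJ2|exact: (cJ2 _ cwP)|].
  by apply: (mean_dist mJ) => //; continuity.
move: h1 h2; rewrite gP// => h1; rewrite distrC => h2.
rewrite (splitr e); exact: le_trans (ler_distD _ _ _) (lerD h1 h2).
Qed.

End group_mean.

(** * Eigenfunctions of symmetric kernels *)

Section growth.
Context (R : realType).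

Lemma bernoulli_ineq (x : R) n : -1 <= x -> 1 + n%:R * x <= (1 + x) ^+ n.
Proof.
move=> x1; elim: n => [|n IH]; first by rewrite mul0r addr0 expr0.
rewrite exprSr; apply: (@le_trans _ _ ((1 + n%:R * x) * (1 + x))).
  rewrite -natr1 mulrDl mul1r mulrDr mulr1 mulrDl mul1r -subr_ge0.
  rewrite (_ : _ - _ = n%:R * x ^+ 2); last by ring.
  by rewrite mulr_ge0 ?sqr_ge0.
by apply: ler_wpM2r => //; lra.
Qed.

Lemma expr_unbounded (x C : R) : 1 < x ->
  exists m0, forall m, (m0 <= m)%N -> C < x ^+ m.
Proof.
move=> x1; exists (Num.bound (`|C| / (x - 1))) => m m0m.
have x0 : 0 < x - 1 by lra.
have := bernoulli_ineq m (ltW (lt_trans (ltrN10 R) x0)).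
rewrite (_ : 1 + (x - 1) = x); last by ring.
apply: lt_le_trans.
have : `|C| / (x - 1) < m%:R.
  apply: (lt_le_trans (archi_boundP _)); first by rewrite divr_ge0// ltW.
  by rewrite ler_nat.
rewrite ltr_pdivrMr// => h; have := ler_norm C; lra.
Qed.

(** The example to have in mind is the trace [t n] of [Q ^ (n + 1)], with [Q] a
    positive operator. Then [L], the limit of the increasing ratios
    [t n.+1 / t n], is the largest eigenvalue of [Q], and [t n / L ^ (n + 1)]
    decreases to its multiplicity, which is at least 1. If the quotient fell
    below 1, submultiplicativity would make it decay exponentially, whereas its own
    ratios tend to 1. *)
Lemma growth_rate (t : nat -> R) :
  (forall n, 0 < t n) ->
  (forall n, t n.+1 ^+ 2 <= t n * t n.+2) ->
  (forall m n, t (m + n).+1 <= t m * t n) ->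
  exists L, [/\ 0 < L, forall n, t n.+1 <= L * t n & forall n, L ^+ n.+1 <= t n].
Proof.
move=> t0 tconv tmul; pose r n := t n.+1 / t n.
have r0 n : 0 < r n by rewrite divr_gt0.
have tr n : t n.+1 = r n * t n by rewrite /r mulfVK// gt_eqF.
have rS n : r n <= r n.+1.
  rewrite /r ler_pdivrMr// mulrAC ler_pdivlMr//.
  by have := tconv n; rewrite expr2 [t n * _]mulrC.
have rmono m n : (m <= n)%N -> r m <= r n.
  move=> /subnK <-; elim: (n - m)%N => // j; rewrite addSn => /le_trans; apply.
  exact: rS.
have rub n : r n <= t 0%N.
  by rewrite /r ler_pdivrMr// mulrC; have := tmul n 0%N; rewrite addn0.
pose L := sup (range r).
have supr : has_sup (range r).
  split; first by exists (r 0%N); exists 0%N.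
  by exists (t 0%N) => _ [n _ <-].
have rL n : r n <= L by apply: ub_le_sup; [exact: supr.2 | exists n].
have L0 : 0 < L by exact: lt_le_trans (rL 0%N).
exists L; split=> // [n|n]; first by rewrite tr ler_pM2r.
rewrite leNgt; apply/negP => tL.
(* Some [rho < L] still satisfies [t n < rho ^ (n + 1)]; from [k0] on, [t] grows
   at least as fast as the powers of [rho]. *)
have [rho [rho0 rhoL trho]] : exists rho, [/\ 0 < rho, rho < L & t n < rho ^+ n.+1].
  pose b := t n / L ^+ n.+1.
  have LN : 0 < L ^+ n.+1 by rewrite exprn_gt0.
  have b1 : b < 1 by rewrite /b ltr_pdivrMr// mul1r.
  have b0 : 0 < b by rewrite divr_gt0.
  pose d := (1 - b) / (2 * n.+1%:R).
  have n0 : 1 <= n.+1%:R :> R by rewrite ler1n.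
  have dE : n.+1%:R * d = (1 - b) / 2 by rewrite /d; field; lra.
  have d0 : 0 < d by rewrite /d divr_gt0//; lra.
  have d1 : d < 1.
    rewrite /d ltr_pdivrMr; last by lra.
    nra.
  exists (L * (1 - d)); split.
  - by apply: mulr_gt0 => //; lra.
  - by rewrite gtr_pMr//; lra.
  have := @bernoulli_ineq (- d) n.+1; rewrite exprMn mulrN dE => /(_ ltac:(lra)) h.
  have -> : t n = L ^+ n.+1 * b by rewrite /b mulrC divfK// gt_eqF.
  rewrite ltr_pM2l//; apply: lt_le_trans h; lra.
have [k0 rk0] : exists k, rho < r k.
  have [_ [k _ <-] h] := sup_adherent (eps := L - rho) ltac:(lra) supr.
  by exists k; move: h; rewrite -/L; lra.
have tlow j : t k0 * rho ^+ j <= t (k0 + j)%N.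
  elim: j => [|j IH]; first by rewrite addn0 expr0 mulr1.
  rewrite addnS tr exprSr mulrA mulrC; apply: ler_pM => //.
  - exact: ltW.
  - by rewrite mulr_ge0// ?exprn_ge0// ltW.
  - by apply/ltW/(lt_le_trans rk0)/rmono; exact: leq_addr.
have tup m : t (m * n.+1 + n)%N <= t n ^+ m.+1.
  elim: m => [|m IH]; first by rewrite mul0n add0n expr1.
  rewrite (_ : (m.+1 * n.+1 + n)%N = ((m * n.+1 + n) + n).+1); last by lia.
  apply: (le_trans (tmul _ _)); rewrite [in leRHS]exprSr; apply: ler_wpM2r => //.
  exact: ltW.
have x1 : 1 < rho ^+ n.+1 / t n by rewrite ltr_pdivlMr// mul1r.
have [m0 /(_ (m0 + k0).+1)] := expr_unbounded (rho ^+ k0.+1 / t k0) x1.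
move=> /(_ ltac:(lia)); apply/negP; rewrite -leNgt.
rewrite expr_div_n ler_pdivrMr ?exprn_gt0// mulrAC ler_pdivlMr//.
pose j := ((m0 + k0) * n.+1 + n - k0)%N.
have jE : (k0 + j = (m0 + k0) * n.+1 + n)%N by rewrite /j subnKC//; nia.
have := tlow j; rewrite jE => /le_trans/(_ (tup _)) h.
rewrite -exprM (_ : (n.+1 * _)%N = (j + k0.+1)%N); last by nia.
rewrite exprD mulrAC [_ * t k0]mulrC [leRHS]mulrC; apply: ler_wpM2r => //.
by rewrite exprn_ge0// ltW.
Qed.

End growth.

Section uniform_limit.
Context (R : realType) (X : topologicalType).

Lemma uniform_cauchy_limit (P : nat -> X -> R) :
  (forall e : R, 0 < e -> exists N, forall m n, (N <= m)%N -> (N <= n)%N ->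
     forall x, `|P m x - P n x| <= e) ->
  exists f, forall e : R, 0 < e -> exists N, forall n, (N <= n)%N ->
     forall x, `|P n x - f x| <= e.
Proof.
move=> cauchyP.
(* The supremum of the eventual lower bounds of [P n x] is its limit. *)
pose S x := [set y | exists N, forall n, (N <= n)%N -> y <= P n x].
exists (fun x => sup (S x)) => e e0; have [N PN] := cauchyP e e0.
exists N => n Nn x.
have Sn : S x (P n x - e).
  by exists N => m Nm; have := PN n m Nn Nm x; rewrite ler_norml; lra.
have ubS : ubound (S x) (P n x + e).
  move=> y [M yM]; have := PN (maxn M N) n (leq_maxr _ _) Nn x.
  by have := yM _ (leq_maxl M N); rewrite ler_norml; lra.
have := ub_le_sup (ex_intro _ _ ubS) Sn.
have := ge_sup (ex_intro _ _ Sn) ubS.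
by rewrite ler_norml; lra.
Qed.

Lemma uniform_limit_continuous (P : nat -> X -> R) (f : X -> R) :
  (forall n, continuous (P n)) ->
  (forall e : R, 0 < e -> exists N, forall n, (N <= n)%N ->
     forall x, `|P n x - f x| <= e) ->
  continuous f.
Proof.
move=> cP Pf; apply: continuousP_real => x e e0.
have [N /(_ _ (leqnn N)) PN] := Pf (e / 3) ltac:(by rewrite divr_gt0).
have := @continuous_near _ _ (P N) x (e / 3) (cP N) ltac:(by rewrite divr_gt0).
apply: filterS => y; have := PN x; have := PN y.
rewrite !ler_norml !ltr_norml; lra.
Qed.

Lemma nonincreasing_cauchy (b : nat -> R) c : (forall n, b n.+1 <= b n) ->
  (forall n, c <= b n) -> forall e : R, 0 < e -> exists N, forall m n,
  (N <= m)%N -> (N <= n)%N -> `|b m - b n| <= e.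
Proof.
move=> bS cb e e0.
have infb : has_inf (range b).
  by split; [exists (b 0%N); exists 0%N | exists c => _ [n _ <-]].
have [_ [N _ <-] bN] := inf_adherent e0 infb.
have mono m : (N <= m)%N -> inf (range b) <= b m <= b N.
  move=> Nm; apply/andP; split; first by apply: ge_inf; [exact: infb.2|exists m].
  move: Nm => /subnK <-; elim: (m - N)%N => // j; rewrite addSn.
  exact: le_trans.
exists N => m n /mono/andP[m1 m2] /mono/andP[n1 n2].
by rewrite ler_norml; apply/andP; split; lra.
Qed.

End uniform_limit.

Lemma normr_le_sqr (R : realDomainType) (x y : R) :
  0 <= y -> x ^+ 2 <= y ^+ 2 -> `|x| <= y.
Proof.
by move=> y0 xy; rewrite -(@ler_pXn2r _ 2) ?nnegrE// real_normK ?num_real.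
Qed.

Section kernels.
Context (R : realType) (G : topologicalGroupType) (J : (G -> R) -> R).
Hypothesis mJ : mean_functional J.
Hypothesis J_inv : translation_invariant J.
Hypothesis G_compact : compact [set: G].
Hypothesis G_hausdorff : hausdorff_space G.
Implicit Types (k l m : G * G -> R).

(** Continuous kernels are treated as integral operators: [kmul] is composition
    and [kdot] is the Hilbert-Schmidt inner product. *)
Definition dmean k : R := J (fun x => J (fun y => k (x, y))).
Definition kmul k l : G * G -> R := fun p => J (fun t => k (p.1, t) * l (t, p.2)).
Definition kdot k l : R := dmean (fun p => k p * l p).

Lemma meanZr c (f : G -> R) : continuous f -> J (fun x => f x * c) = J f * c.
Proof.
move=> cf; rewrite mulrC -(meanZ mJ)//; congr J.
by apply: funext => x; rewrite mulrC.
Qed.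

Let cJ1 k : continuous k -> continuous (fun x => J (fun y => k (x, y))).
Proof. exact: continuous_mean. Qed.

Lemma dmean_functional : mean_functional dmean.
Proof.
split; rewrite /dmean.
- by rewrite !(mean1 mJ).
- move=> k l ck cl; rewrite -(meanD mJ) //; [|exact: cJ1|exact: cJ1].
  by congr J; apply: funext => x; rewrite (meanD mJ)//; continuity.
- move=> c k ck; rewrite -(meanZ mJ) //; last exact: cJ1.
  by congr J; apply: funext => x; rewrite (meanZ mJ)//; continuity.
- move=> k l ck cl kl; apply: (le_mean mJ); [exact: cJ1|exact: cJ1|].
  by move=> x; apply: (le_mean mJ) => //; continuity.
Qed.

Let mD := dmean_functional.

Lemma continuous_kmul k l : continuous k -> continuous l -> continuous (kmul k l).
Proof.
move=> ck cl.
apply: (continuous_mean mJ G_compact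
  (F := fun p : (G * G) * G => k (p.1.1, p.2) * l (p.2, p.1.2))).
by continuity.
Qed.

Lemma kmulA k l m : continuous k -> continuous l -> continuous m ->
  kmul (kmul k l) m = kmul k (kmul l m).
Proof.
move=> ck cl cm; apply: funext => -[x y]; rewrite /kmul /=.
transitivity (J (fun t => J (fun s => k (x, s) * l (s, t) * m (t, y)))).
  by congr J; apply: funext => t; rewrite meanZr//; continuity.
rewrite (mean_exchange mJ G_compact G_hausdorff
  (F := fun p => k (x, p.2) * l (p.2, p.1) * m (p.1, y))); last by continuity.
congr J; apply: funext => s /=; rewrite -(meanZ mJ); last by continuity.
by congr J; apply: funext => t; rewrite mulrA.
Qed.

Lemma kmulZr c k l : continuous k -> continuous l ->
  kmul k (fun r => c * l r) = fun r => c * kmul k l r.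
Proof.
move=> ck cl; apply: funext => r; rewrite /kmul -(meanZ mJ); last by continuity.
by congr J; apply: funext => s; rewrite mulrCA.
Qed.

Lemma kmulZl c k l : continuous k -> continuous l ->
  kmul (fun r => c * k r) l = fun r => c * kmul k l r.
Proof.
move=> ck cl; apply: funext => r; rewrite /kmul -(meanZ mJ); last by continuity.
by congr J; apply: funext => s; rewrite mulrA.
Qed.

Lemma kmulBr k l m : continuous k -> continuous l -> continuous m ->
  kmul k (fun r => l r - m r) = fun r => kmul k l r - kmul k m r.
Proof.
move=> ck cl cm; apply: funext => r.
rewrite /kmul -(meanB mJ); [|continuity|continuity].
by congr J; apply: funext => s; rewrite mulrBr.
Qed.

Lemma kmulBl k l m : continuous k -> continuous l -> continuous m ->
  kmul (fun r => k r - l r) m = fun r => kmul k m r - kmul l m r.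
Proof.
move=> ck cl cm; apply: funext => r.
rewrite /kmul -(meanB mJ); [|continuity|continuity].
by congr J; apply: funext => s; rewrite mulrBl.
Qed.

Lemma mean_mul_bound (f g : G -> R) C : continuous f -> continuous g ->
  (forall x, `|f x| <= C) ->
  J (fun x => f x * g x) ^+ 2 <= C ^+ 2 * J (fun x => g x * g x).
Proof.
move=> cf cg fC; apply: (le_trans (mean_cauchy_schwarz mJ cf cg)).
apply: ler_wpM2r.
  by apply: (mean_ge0 mJ) => [|x]; [continuity|rewrite -expr2 sqr_ge0].
apply: (mean_le mJ) => [|x]; first by continuity.
rewrite -expr2 -[leLHS]real_normK ?num_real//.
by rewrite lerXn2r// nnegrE// (le_trans _ (fC x)).
Qed.

Lemma kmul_le k l C e r : continuous k -> continuous l ->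
  (forall r, `|k r| <= C) -> (forall r, `|l r| <= e) -> `|kmul k l r| <= C * e.
Proof.
move=> ck cl kC le; apply: (normr_mean mJ) => [|s]; first by continuity.
by rewrite normrM; apply: ler_pM.
Qed.

(** Composing with a bounded kernel on both sides turns convergence in the
    Hilbert-Schmidt norm into uniform convergence. *)
Lemma kmul_sandwich_bound a k C r : continuous a -> continuous k ->
  (forall r, `|a r| <= C) ->
  kmul a (kmul k a) r ^+ 2 <= C ^+ 4 * kdot k k.
Proof.
case: r => x y ca ck aC.
have [ka [kaE cka]] : exists ka, ka = kmul k a /\ continuous ka.
  by exists (kmul k a); split=> //; exact: continuous_kmul.
rewrite -kaE /kmul /=.
apply: (le_trans (mean_mul_bound (C := C) (f := fun s => a (x, s))
  (g := fun s => ka (s, y)) _ _ _)) => //; [by continuity|by continuity|].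
rewrite (_ : C ^+ 4 = C ^+ 2 * C ^+ 2); last by rewrite -exprD.
rewrite -mulrA; apply: ler_wpM2l; first exact: sqr_ge0.
have ckk : continuous (fun p => k p * k p) by continuity.
rewrite /kdot /dmean -(meanZ mJ); last exact: (cJ1 ckk).
apply: (le_mean mJ).
- by continuity.
- by apply: continuousMr; [continuity | exact: (cJ1 ckk)].
move=> s; rewrite -expr2 kaE /kmul /=.
have -> : (fun t => k (s, t) * a (t, y)) = fun t => a (t, y) * k (s, t).
  by apply: funext => t; rewrite mulrC.
by apply: (mean_mul_bound (C := C) (f := fun t => a (t, y))
  (g := fun t => k (s, t))); try continuity.
Qed.

Lemma kdot_kmul k l : continuous k -> continuous l ->
  kdot (kmul k l) (kmul k l) <= kdot k k * kdot l l.
Proof.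
move=> ck cl; have ckl := continuous_kmul ck cl.
pose A x := J (fun t => k (x, t) * k (x, t)).
pose B y := J (fun t => l (t, y) * l (t, y)).
have cA : continuous A.
  by apply: (continuous_mean mJ G_compact (F := fun p => k p * k p)); continuity.
have cB : continuous B.
  apply: (continuous_mean mJ G_compact
    (F := fun p => l (p.2, p.1) * l (p.2, p.1))).
  by continuity.
apply: (@le_trans _ _ (dmean (fun p => A p.1 * B p.2))).
  apply: (le_mean mD); [continuity|continuity|] => -[x y] /=; rewrite -expr2.
  by apply: (mean_cauchy_schwarz mJ
    (f := fun t => k (x, t)) (g := fun t => l (t, y))); continuity.
rewrite /dmean /=.
rewrite (_ : (fun x => J (fun y => A x * B y)) = fun x => A x * J B); last first.
  by apply: funext => x; rewrite (meanZ mJ).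
rewrite meanZr// /kdot /dmean.
suff -> : J B = J (fun x => J (fun y => l (x, y) * l (x, y))) by [].
rewrite /B -(mean_exchange mJ G_compact G_hausdorff (F := fun p => l p * l p))//.
by continuity.
Qed.

Lemma kdot_gt0 k p : continuous k -> k p != 0 -> 0 < kdot k k.
Proof.
case: p => x y ck kxy.
have c2 : continuous (fun p => k p * k p) by continuity.
have kk0 p : 0 <= k p * k p by rewrite -expr2 sqr_ge0.
rewrite lt0r (mean_ge0 mD)// andbT; apply/eqP => k0.
have ckx u : continuous (fun y => k (u, y) * k (u, y)) by continuity.
have h1 := mean_eq0 mJ J_inv G_compact (cJ1 c2)
  (fun u => mean_ge0 mJ (ckx u) (fun y => kk0 (u, y))) k0.
have /eqP := mean_eq0 mJ J_inv G_compact (ckx x) (fun y => kk0 (x, y)) (h1 x) y.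
by rewrite mulf_eq0 (negbTE kxy).
Qed.

Section powers.
Context (q : G * G -> R).
Hypothesis cq : continuous q.
Hypothesis q_sym : forall x y, q (x, y) = q (y, x).

(** Operators with a continuous kernel have no unit, so the powers start with
    [kpow 0 = q]. *)
Fixpoint kpow n := if n is m.+1 then kmul (kpow m) q else q.

Lemma continuous_kpow n : continuous (kpow n).
Proof. by elim: n => //= n IH; exact: continuous_kmul. Qed.

Lemma kpowD (m n : nat) : kmul (kpow m) (kpow n) = kpow (m + n).+1.
Proof.
elim: n => [|n IH]; first by rewrite addn0.
rewrite addnS -[kpow (m + n).+2]/(kmul (kpow (m + n).+1) q) -IH kmulA//.
  exact: continuous_kpow.
exact: continuous_kpow.
Qed.

Lemma kpow_sym n x y : kpow n (x, y) = kpow n (y, x).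
Proof.
elim: n x y => //= n IH x y.
transitivity (kmul (kpow 0) (kpow n) (y, x)); last by rewrite kpowD add0n.
by rewrite /kmul /=; congr J; apply: funext => t; rewrite IH q_sym mulrC.
Qed.

(** Both sides are the trace of the same power of [q]. *)
Lemma kdot_kpow (m n m' n' : nat) : (m + n = m' + n')%N ->
  kdot (kpow m) (kpow n) = kdot (kpow m') (kpow n').
Proof.
suff tr a b : kdot (kpow a) (kpow b) = J (fun x => kpow (a + b).+1 (x, x)).
  by move=> e; rewrite !tr e.
rewrite /kdot /dmean; congr J; apply: funext => x; rewrite -kpowD /kmul /=.
by congr J; apply: funext => y; rewrite [kpow b (y, x)]kpow_sym.
Qed.

Let t n := kdot (kpow n) (kpow n).

Lemma kpow_growth p : q p != 0 ->
  exists L, [/\ 0 < L, forall n, t n.+1 <= L * t n & forall n, L ^+ n.+1 <= t n].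
Proof.
move=> qp.
have tconv n : t n.+1 ^+ 2 <= t n * t n.+2.
  rewrite /t (_ : kdot (kpow n.+1) (kpow n.+1) = kdot (kpow n) (kpow n.+2)); last first.
    by apply: kdot_kpow; lia.
  by apply: (mean_cauchy_schwarz mD (f := kpow n) (g := kpow n.+2));
    exact: continuous_kpow.
have tmul (m n : nat) : t (m + n).+1 <= t m * t n.
  by rewrite /t -kpowD; apply: kdot_kmul; exact: continuous_kpow.
have t0 : 0 < t 0%N by exact: (@kdot_gt0 q p).
have t1 : 0 < t 1%N.
  apply: (@kdot_gt0 (kpow 1) (p.1, p.1)); first exact: (@continuous_kpow 1).
  rewrite /kpow /kmul /=; apply/eqP => h.
  have h' : J (fun y => q (p.1, y) * q (p.1, y)) = 0.
    by rewrite -[RHS]h; congr J; apply: funext => y; rewrite [q (y, _)]q_sym.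
  have cqp : continuous (fun y => q (p.1, y) * q (p.1, y)) by continuity.
  have qq0 y : 0 <= q (p.1, y) * q (p.1, y) by rewrite -expr2 sqr_ge0.
  have /eqP := mean_eq0 mJ J_inv G_compact cqp qq0 h' p.2.
  by rewrite -surjective_pairing mulf_eq0 (negbTE qp).
apply: growth_rate => // n.
suff : 0 < t n /\ 0 < t n.+1 by case.
elim: n => // n [tn tSn]; split=> //.
have := tconv n; rewrite -(pmulr_rgt0 _ tn); apply: lt_le_trans.
by rewrite exprn_gt0.
Qed.

Let a := kpow 1.

Let ca : continuous a.
Proof. exact: (@continuous_kpow 1). Qed.

(** The powers of [Q = q ^ 2], divided by the powers of its largest eigenvalue
    [L], converge to the projection onto the eigenspace of [L]; any nonzero column of
    the limit kernel is an eigenfunction. *)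
Lemma top_eigenfunction p : q p != 0 -> exists L (f : G -> R),
  [/\ 0 < L, continuous f, exists x, f x != 0 &
      forall x, J (fun s => kpow 1 (x, s) * f s) = L * f x].
Proof.
move=> qp; have [L [L0 tL Lt]] := kpow_growth qp.
have LX0 n : 0 < L ^+ n by exact: exprn_gt0.
have LXn0 n : L ^+ n != 0 by rewrite gt_eqF.
pose b n := t n / L ^+ n.+1.
have b1 n : 1 <= b n by rewrite /b ler_pdivlMr// mul1r.
have bS n : b n.+1 <= b n.
  rewrite /b [L ^+ n.+2]exprS invfM mulrA; apply: ler_wpM2r.
    by rewrite invr_ge0 ltW.
  by rewrite ler_pdivrMr// mulrC.
(* [P n] is the kernel of [(Q / L) ^ (n + 1)], whose inner products [b] form a
   Cauchy sequence. *)
pose c n := (L ^+ n.+1)^-1.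
pose P n r := c n * kpow (n + n).+1 r.
have cP n : continuous (P n).
  by apply: continuousMr; [continuity | exact: continuous_kpow].
have PP (n m : nat) : kdot (P n) (P m) = b (n + m).+1.
  rewrite /kdot (_ : (fun r => _) = fun r =>
    (c n * c m) * (kpow (n + n).+1 r * kpow (m + m).+1 r)); last first.
    by apply: funext => r; rewrite /P mulrACA.
  rewrite (meanZ mD); last by apply: continuousMr; exact: continuous_kpow.
  rewrite -/(kdot _ _) (@kdot_kpow _ _ (n + m).+1 (n + m).+1); last by lia.
  rewrite mulrC /b /t; congr (_ * _); rewrite /c -invfM -exprD.
  by congr (_ ^+ _)^-1; lia.
have cstep n : c n = L * c n.+1.
  by rewrite /c [L ^+ n.+2]exprS invfM mulrA divff ?mul1r// gt_eqF.
have aP n : kmul a (P n) = fun r => L * P n.+1 r.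
  rewrite /P kmulZr//; last exact: continuous_kpow.
  apply: funext => r; rewrite kpowD cstep mulrA.
  by congr (_ * kpow _ _); lia.
have Pa n : kmul (P n) a = fun r => L * P n.+1 r.
  rewrite /P kmulZl//; last exact: continuous_kpow.
  apply: funext => r; rewrite kpowD cstep mulrA.
  by congr (_ * kpow _ _); lia.
have [C C1 aC] : exists2 C, 1 <= C & forall r, `|a r| <= C.
  have GG : compact [set: G * G] by rewrite -setXTT; exact: compact_setX.
  have [C C0 aC] := @compact_continuous_bounded R (G * G)%type a GG ca.
  by exists (C + 1) => [|r]; [rewrite lerDr | rewrite (le_trans (aC r))// lerDl].
have C0 : 0 < C by exact: lt_le_trans C1.
(* Composing with [a] on both sides raises the index by two. *)
have bound (n m : nat) r : (L ^+ 2 * (P n.+2 r - P m.+2 r)) ^+ 2 <=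
    C ^+ 4 * (b (n + n).+1 + b (m + m).+1 - 2 * b (n + m).+1).
  have cn := cP n; have cm := cP m; have cn1 := cP n.+1; have cm1 := cP m.+1.
  have -> : L ^+ 2 * (P n.+2 r - P m.+2 r) =
      kmul a (kmul (fun r => P n r - P m r) a) r.
    rewrite kmulBl// !Pa kmulBr//; [|by continuity|by continuity].
    by rewrite (kmulZr L ca cn1) (kmulZr L ca cm1) !aP; ring.
  have -> : b (n + n).+1 + b (m + m).+1 - 2 * b (n + m).+1 =
      kdot (fun r => P n r - P m r) (fun r => P n r - P m r).
    rewrite -!PP /kdot.
    rewrite (_ : (fun r => (P n r - P m r) * _) =
      fun r => (P n r * P n r + P m r * P m r) - 2 * (P n r * P m r)).
      by rewrite (meanB mD) ?(meanD mD) ?(meanZ mD)//; continuity.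
    by apply: funext => s; ring.
  by apply: kmul_sandwich_bound => //; continuity.
have [f Pf] : exists f, forall e : R, 0 < e -> exists N, forall n, (N <= n)%N ->
     forall r, `|P n r - f r| <= e.
  apply: uniform_cauchy_limit => e e0.
  have eta0 : 0 < (L ^+ 2 * e) ^+ 2 / (2 * C ^+ 4).
    by rewrite divr_gt0 ?mulr_gt0 ?exprn_gt0 ?mulr_gt0.
  have [N bN] := nonincreasing_cauchy bS b1 eta0.
  exists N.+2 => -[//|[//|m]] [//|[//|n]] Nm Nn r.
  rewrite !ltnS in Nm Nn.
  suff : `|L ^+ 2 * (P m.+2 r - P n.+2 r)| <= L ^+ 2 * e.
    by rewrite normrM gtr0_norm// ler_pM2l.
  apply: normr_le_sqr; first by rewrite mulr_ge0// ltW.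
  apply: (le_trans (bound m n r)).
  have h1 := bN (m + m).+1 (m + n).+1 ltac:(lia) ltac:(lia).
  have h2 := bN (n + n).+1 (m + n).+1 ltac:(lia) ltac:(lia).
  have C4 : 0 < C ^+ 4 by exact: exprn_gt0.
  rewrite mulrC -ler_pdivlMr//; move: h1 h2; rewrite !ler_norml invfM mulrA.
  rewrite mulrAC => /andP[_ h1] /andP[_ h2].
  by have := splitr ((L ^+ 2 * e) ^+ 2 / C ^+ 4); lra.
have cf : continuous f by exact: uniform_limit_continuous Pf.
(* The norms of the [P n] are at least 1, so their limit is not zero. *)
have [[x y] fxy] : exists r, f r != 0.
  apply: contrapT => f0.
  have [N /(_ N (leqnn N)) PN] := Pf (1 / 2) ltac:(lra).
  have : kdot (P N) (P N) <= 1 / 4.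
    have cn := cP N; rewrite /kdot; apply: (mean_le mD) => [|r]; first by continuity.
    have := PN r; have -> : f r = 0 by apply/eqP/negPn/negP => fr; apply: f0; exists r.
    rewrite subr0 ler_norml => /andP[h1 h2].
    nra.
  by rewrite PP; have := b1 (N + N).+1; lra.
exists L, (fun s => f (s, y)); split=> //; [by continuity|by exists x|].
move=> u; apply/eqP; rewrite -subr_eq0 -normr_eq0 eq_le normr_ge0 andbT.
apply/ler_addgt0Pr => e e0; rewrite add0r.
have d0 : 0 < e / (C + L) by rewrite divr_gt0// addr_gt0.
have [N PN] := Pf _ d0.
have cn := cP N.
have h1 : `|kmul a f (u, y) - kmul a (P N) (u, y)| <= C * (e / (C + L)).
  have -> : kmul a f (u, y) - kmul a (P N) (u, y) =
      kmul a (fun r => f r - P N r) (u, y) by rewrite kmulBr.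
  apply: kmul_le => //; first by continuity.
  by move=> r; rewrite distrC; exact: PN.
have h2 : `|L * P N.+1 (u, y) - L * f (u, y)| <= L * (e / (C + L)).
  rewrite -mulrBr normrM gtr0_norm//; apply: ler_wpM2l; first exact: ltW.
  exact: PN.
have := le_trans (ler_distD (kmul a (P N) (u, y)) _ _) (lerD h1 _).
move=> /(_ _ _ _); rewrite aP => /(_ _ _ h2); rewrite -mulrDl mulrCA divff ?mulr1//.
by rewrite gt_eqF// addr_gt0.
Qed.

End powers.
End kernels.

(** * Small subgroups *)

Section small_subgroups.
Context (R : realType) (G : topologicalGroupType) (J : (G -> R) -> R).
Hypothesis mJ : mean_functional J.
Hypothesis J_inv : translation_invariant J.
Hypothesis G_compact : compact [set: G].
Hypothesis G_hausdorff : hausdorff_space G.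

(** Write [D] for the operator [f |-> f (s * _) - f], which satisfies
    [|D| <= 1/2] for all [s] in [S]. If also [|D| <= c] for all [s] in [S], this
    improves to [|D| <= 3/4 c], as [2 D f] is the difference of
    [f (s ^ 2 * _) - f] and [D (D f)], whose norms are at most [c |f|] and
    [c |f| / 2]. *)
Lemma nearly_invariant (V : (G -> R) -> Prop) (S : set G) :
  subgroup S ->
  (forall f s, V f -> S s -> V (fun x => f (s * x)%g - f x)) ->
  (forall f s M, V f -> S s -> (forall x, `|f x| <= M) ->
     forall x, `|f (s * x)%g - f x| <= M / 2) ->
  forall f M s, V f -> (forall x, `|f x| <= M) -> S s ->
  forall x, f (s * x)%g = f x.
Proof.
move=> gS VB half f M s Vf fM Ss x.
have M0 : 0 <= M by exact: le_trans (fM x).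
have step n : forall g N u, V g -> (forall y, `|g y| <= N) -> S u ->
    forall y, `|g (u * y)%g - g y| <= (3 / 4) ^+ n * N.
  elim: n => [|n IH] g N u Vg gN Su y.
    have N0 : 0 <= N by exact: le_trans (gN y).
    by rewrite expr0 mul1r (le_trans (half _ _ _ Vg Su gN y))//; lra.
  have h1 := IH _ _ _ Vg gN (subgroupM gS Su Su) y.
  have h2 := half _ _ _ (VB _ _ Vg Su) Su (IH _ _ _ Vg gN Su) y.
  move: h1 h2; rewrite /= -mulgA exprS -mulrA !ler_norml.
  by move=> /andP[? ?] /andP[? ?]; apply/andP; split; lra.
apply/eqP; rewrite -subr_eq0 -normr_eq0 eq_le normr_ge0 andbT leNgt.
apply/negP => d0.
have [n0 /(_ n0 (leqnn _)) h] :=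
  @expr_unbounded R (4 / 3) (M / `|f (s * x)%g - f x|) ltac:(lra).
have := step n0 f M s Vf fM Ss x; apply/negP; rewrite -ltNge.
rewrite ltr_pdivrMr// in h.
have -> : (3 / 4 : R) = (4 / 3)^-1 by field.
by rewrite exprVn mulrC ltr_pdivrMr 1?mulrC// exprn_gt0//; lra.
Qed.

Section separate.
Context (z : G).
Hypothesis z1 : z != 1%g.

Lemma symmetric_bump : exists h : G -> R,
  [/\ continuous h, forall g, h g^-1%g = h g, h 1%g = 2 & h z = 0].
Proof.
have U1 : nbhs (1%g : G) [set g | g != z /\ g != z^-1%g].
  have c1 (u : G) : closed [set u].
    by apply: accessible_closed_set1; exact: hausdorff_accessible.
  have : \forall g \near (1%g : G), ~ [set z] g /\ ~ [set z^-1%g] g.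
    apply: filterI.
      apply: (near_closedC (f := id)) => //; first exact: continuous_idfun.
      by move=> /= e; move: z1; rewrite e eqxx.
    apply: (near_closedC (f := id)) => //; first exact: continuous_idfun.
    by move=> /= e; move: z1; rewrite -[z]invgK -e invg1 eqxx.
  by apply: filterS => g [/eqP ? /eqP ?].
have [b [cb b0 b1 bz]] := @bump_function R G G_compact G_hausdorff _ _ U1.
exists (fun g => b g + b g^-1%g); split.
- by continuity.
- by move=> g; rewrite invgK addrC.
- by rewrite invg1 b1.
- by rewrite !bz ?addr0// => -[]; rewrite ?eqxx.
Qed.

(** The kernel [r] is [h (x^-1 * y)] minus the mean of its two translates by [z] and
    its inverse. So the operator [r] kills [z]-invariant functions, while [r] is nonzero
    because [h] separates [1] from [z]. It commutes with translations by the
    centralizer of [z], which therefore act on its eigenspaces. *)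
Lemma small_subgroups_mod : exists (K U : set G),
  [/\ subgroup K, ~ K z, nbhs 1%g U &
   forall S, subgroup S -> S `<=` U -> (forall s, S s -> commute s z) -> S `<=` K].
Proof.
have [h [ch hV h1 hz]] := symmetric_bump.
pose r (p : G * G) := h (p.1^-1 * p.2)%g
  - 2^-1 * (h (p.1^-1 * (z^-1 * p.2))%g + h (p.1^-1 * (z * p.2))%g).
have cr : continuous r by rewrite /r; continuity.
have r_sym x y : r (x, y) = r (y, x).
  rewrite /r /= -[h (x^-1 * y)%g]hV -[h (x^-1 * (z * y))%g]hV.
  rewrite -[h (x^-1 * (z^-1 * y))%g]hV.
  by rewrite !invgM !invgK -!mulgA [h _ + h _]addrC.
have r11 : r (1, 1)%g != 0.
  by rewrite /r /= invg1 !mul1g !mulg1 hV h1 hz addr0 mulr0 subr0.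
have r_inv s x y : commute s z -> r (s * x, s * y)%g = r (x, y).
  move=> sz; rewrite /r /= !invgM.
  have sz' : commute s z^-1 by apply: commuteV.
  by rewrite ![(z * (s * y))%g]mulgA ![(z^-1 * (s * y))%g]mulgA -sz -sz' -!mulgA !mulKg.
have [L [f0 [L0 cf0 [x0 f00] f0E]]] :=
  top_eigenfunction mJ J_inv G_compact G_hausdorff cr r_sym r11.
set a := kpow J r 1 in f0E.
have ca : continuous a by exact: (continuous_kpow mJ G_compact cr (n := 1)).
have a_inv s x y : commute s z -> a (s * x, s * y)%g = a (x, y).
  move=> sz; rewrite /a /= /kmul /=.
  rewrite -(J_inv s (f := fun t => r (s * x, t)%g * r (t, s * y)%g)).
    2: by continuity.
  by congr J; apply: funext => t; rewrite !r_inv.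
pose V (f : G -> R) := continuous f /\ forall x, J (fun t => a (x, t) * f t) = L * f x.
have Vtr f s : V f -> commute s z -> V (fun x => f (s * x)%g).
  move=> [cf fE] sz; split; first by continuity.
  move=> x; rewrite -fE -(J_inv s (f := fun t => a (s * x, t)%g * f t)).
    2: by continuity.
  by congr J; apply: funext => t; rewrite a_inv.
have VB f g : V f -> V g -> V (fun x => f x - g x).
  move=> [cf fE] [cg gE]; split; first by continuity.
  move=> x; rewrite mulrBr -fE -gE -(meanB mJ); [|continuity|continuity].
  by congr J; apply: funext => t; rewrite mulrBr.
have Vz f : V f -> (forall x, f (z * x)%g = f x) -> forall x, f x = 0.
  move=> [cf fE] fz x.
  have rf u : J (fun t => r (u, t) * f t) = 0.
    have e1 : J (fun t => h (u^-1 * (z^-1 * t))%g * f t) =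
        J (fun t => h (u^-1 * t)%g * f t).
      rewrite -(J_inv z); last by continuity.
      by congr J; apply: funext => t; rewrite mulKg fz.
    have e2 : J (fun t => h (u^-1 * (z * t))%g * f t) =
        J (fun t => h (u^-1 * t)%g * f t).
      rewrite -[RHS](J_inv z); last by continuity.
      by congr J; apply: funext => t; rewrite fz.
    rewrite (_ : (fun t => _) = fun t => h (u^-1 * t)%g * f t
      - 2^-1 * (h (u^-1 * (z^-1 * t))%g * f t
                + h (u^-1 * (z * t))%g * f t)); last first.
      by apply: funext => t; rewrite /r /=; ring.
    rewrite (meanB mJ); [|continuity|continuity].
    rewrite (meanZ mJ); last by continuity.
    rewrite (meanD mJ); [|continuity|continuity].
    by rewrite e1 e2; lra.
  have := fE x.
  (* Viewing [f] as a kernel makes the associativity of [kmul] available. *)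
  pose m (p : G * G) := f p.1.
  have cm : continuous m by rewrite /m; continuity.
  rewrite -[J _]/(kmul J (kmul J r r) m (x, x)).
  rewrite (kmulA mJ G_compact G_hausdorff cr cr cm).
  rewrite (_ : kmul J r m = fun=> 0); last by apply: funext => p; exact: rf.
  rewrite /kmul /= (_ : (fun t => r (x, t) * 0) = fun=> 0); last first.
    by apply: funext => t; rewrite mulr0.
  by rewrite (mean_cst mJ) => /esym/eqP; rewrite mulf_eq0 gt_eqF//= => /eqP.
pose K := [set s | forall f, V f -> forall x, f (s * x)%g = f x].
(* As [f] in [V] is the integral of [a] against [f / L], a translation by an
   element of [U] moves it by at most half its norm. *)
pose F (w : G * (G * G)) := a (w.1 * w.2.1, w.2.2)%g.
pose U := [set s | forall p, `|F (s, p) - F (1%g, p)| < L / 2].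
have U1 : nbhs (1%g : G) U.
  apply: continuous_near_uniform; last by rewrite divr_gt0.
    by rewrite -setXTT; exact: compact_setX.
  by rewrite /F; continuity.
exists K, U; split=> //.
- apply/subgroupP; split=> [f _ x|s t Ks Kt f Vf x]; first by rewrite mul1g.
  by rewrite -mulgA Ks// -[in RHS](mulVKg t x) Kt.
- by move=> Kz; move: f00; rewrite (Vz f0) ?eqxx// => x; exact: Kz.
move=> S gS SU Sz s Ss f Vf x.
have [M M0 fM] := compact_continuous_bounded G_compact Vf.1.
apply: (@nearly_invariant V S gS _ _ f M s Vf fM Ss).
  by move=> g u Vg Su; apply: VB => //; apply: Vtr => //; exact: Sz.
move=> g u N Vg Su gN y; have [cg gE] := Vg.
rewrite -(ler_pM2l L0) -[X in X * `|_|](gtr0_norm L0) -normrM mulrBr -!gE.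
rewrite -(meanB mJ); [|continuity|continuity].
apply: (normr_mean mJ) => [|t]; first by continuity.
rewrite -mulrBl normrM (_ : L * (N / 2) = L / 2 * N); last by field.
apply: ler_pM => //.
by have := ltW (SU u Su (y, t)); rewrite /F /= mul1g.
Qed.

End separate.
End small_subgroups.

Local Close Scope ring_scope.
Local Open Scope group_scope.

(** * The identity component *)

Section identity_component.
Context (G : topologicalGroupType).
Implicit Types A M N U : set G.

Lemma identity_component_subgroup : subgroup (identity_component G).
Proof.
apply/subgroupP; split=> [|x y Ax Ay]; first exact: connected_component_refl.
pose B := [set a * y^-1 | a in identity_component G].
suff : B `<=` identity_component G by apply; exists x.
apply: connected_component_max => //; first by exists y => //; rewrite mulgV.
apply: connected_continuous_connected; first exact: component_connected.
apply: continuous_subspaceT.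
have c : continuous (fun a : G => a * y^-1) by continuity.
exact: c.
Qed.

Lemma open_translates M U : open U -> open [set g | exists2 m, M m & U (m^-1 * g)].
Proof.
move=> oU; rewrite openE => g [m Mm Ug]; rewrite /interior.
have : \forall g' \near g, U (m^-1 * g') by apply: near_openP => //; continuity.
by apply: filterS => g' Ug'; exists m.
Qed.

(** The translates of [U] make both [M] and its complement open in [A]. *)
Lemma connected_sub_subgroup A M U : connected A -> subgroup A -> subgroup M ->
  M `<=` A -> nbhs 1 U -> (forall x, A x -> U x -> M x) -> A `<=` M.
Proof.
move=> cA gA gM MA; rewrite nbhsE => -[V [oV V1] VU] AU.
have AV x : A x -> V x -> M x by move=> Ax /VU; exact: AU.
suff -> : M = A by [].
apply: cA; first by exists 1; exact: subgroup1.
  exists [set g | exists2 m, M m & V (m^-1 * g)]; first exact: open_translates.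
  apply/seteqP; split=> [g Mg|g [Ag [m Mm Vg]]].
    by split; [exact: MA | exists g => //; rewrite mulVg].
  rewrite -[g](mulVKg m); apply: subgroupM => //; apply: AV => //.
  by apply: subgroupM => //; apply: subgroupV => //; exact: MA.
exists (~` [set g | exists2 a, (A `\` M) a & V (a^-1 * g)]).
  by apply: open_closedC; exact: open_translates.
apply/seteqP; split=> [g Mg|g [Ag nV]].
  split=> [|[a [Aa nMa] Vg]]; first exact: MA.
  apply: nMa; have Mag : M (a^-1 * g).
    by apply: AV => //; apply: subgroupM; [|exact: subgroupV|exact: MA].
  rewrite (_ : a = g * (a^-1 * g)^-1); last by rewrite invgM invgK mulVKg.
  by apply: subgroupM => //; exact: subgroupV.
by apply: contrapT => nMg; apply: nV; exists g => //; rewrite mulVg.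
Qed.

Lemma identity_component_sub N : subgroup N -> open N ->
  identity_component G `<=` N.
Proof.
move=> gN oN; have gA := identity_component_subgroup.
suff h : identity_component G `<=` identity_component G `&` N by move=> x /h[].
apply: (@connected_sub_subgroup _ _ N) => //.
- exact: component_connected.
- exact: subgroupI.
- by apply: open_nbhs_nbhs; split=> //; exact: subgroup1.
Qed.

Context (R : realType) (J : (G -> R) -> R).
Hypothesis mJ : mean_functional J.
Hypothesis J_inv : translation_invariant J.
Hypothesis G_compact : compact [set: G].
Hypothesis G_hausdorff : hausdorff_space G.

(** The subgroup [D = lower_central A n.+1] is central in [A], so that [[y, a]] is
    multiplicative in each variable. For [a] near [1] these commutators form a small
    subgroup, which lies in the subgroup [K] given by [small_subgroups_mod]
    for a commutator [z = [y0, a0]] other than [1]. Hence the elements [a] with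
    [[L, a]] inside [K] form an open subgroup of [A]. *)
Lemma connected_lower_central_eq1 A n : connected A -> subgroup A ->
  lower_central A n.+2 `<=` [set 1] -> lower_central A n.+1 `<=` [set 1].
Proof.
move=> cA gA A1; set L := lower_central A n; set D := lower_central A n.+1.
have DA : D `<=` A by exact: lower_central_sub.
have gL : subgroup L by exact: subgroup_lower_central.
have D_central w b : D w -> A b -> commute w b.
  by move=> Dw Ab; apply/commgP/eqP; apply: A1; exact: mem_comm.
have DJ w b : D w -> A b -> w ^ b = w.
  by move=> Dw Ab; apply/conjg_fixP/commgP; exact: D_central.
have D_comm y a : L y -> A a -> D [~ y, a] by move=> Ly Aa; exact: mem_comm.
have LA : L `<=` A by exact: lower_central_sub.
apply: comm_sub => [|y0 a0 Ly0 Aa0]; first by case: (normal_subgroup1 G).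
apply: contrapT => /eqP z1.
have [K [U [gK nKz U1 UK]]] := small_subgroups_mod mJ J_inv G_compact G_hausdorff z1.
pose M := [set a | A a /\ forall y, L y -> K [~ y, a]].
suff AM : A `<=` M by apply: nKz; exact: (AM a0 Aa0).2.
pose W := [set a | forall y, [set: G] y -> U [~ y, a]].
have W1 : nbhs 1 W.
  apply: (@tube _ _ _ _ (fun p => U [~ p.2, p.1])) => // y _.
  apply: (near_nbhsP (f := fun p : G * G => [~ p.2, p.1])); last by continuity.
  by rewrite /= commg1.
apply: (connected_sub_subgroup (U := W)) => //.
- have MV a : M a -> M a^-1.
    move=> [Aa Ka]; split=> [|y Ly]; first exact: subgroupV.
    have := commgMJ y a a^-1; rewrite mulgV commg1 => /esym/mulg1_eq e.
    rewrite -[[~ y, a^-1]]invgK e DJ; [|exact: D_comm|exact: subgroupV].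
    by apply: subgroupV => //; exact: Ka.
  apply/subgroupP; split=> [|a b [Aa Ka] /MV[Ab Kb]].
    by split=> [|y _]; rewrite ?commg1; exact: subgroup1.
  split=> [|y Ly]; first exact: subgroupM.
  rewrite commgMJ DJ//; last exact: D_comm.
  by apply: subgroupM => //; [exact: Kb | exact: Ka].
- by move=> a [].
move=> a Aa Wa; split=> // y Ly.
pose S := [set [~ y, a] | y in L].
apply: (UK S); last by exists y.
- apply/subgroupP; split; first by exists 1; [exact: subgroup1 | rewrite comm1g].
  move=> _ _ [u Lu <-] [v Lv <-]; exists (u * v^-1).
    by apply: subgroupM => //; exact: subgroupV.
  have := commMgJ (u * v^-1) v a; rewrite mulgVK DJ.
  + by move=> ->; rewrite mulgK.
  + by apply: D_comm => //; apply: subgroupM => //; exact: subgroupV.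
  + exact: LA.
- by move=> _ [u _ <-]; exact: Wa.
- move=> _ [u Lu <-]; apply: D_central; first exact: D_comm.
  by apply: DA; exact: D_comm.
Qed.

Lemma connected_nilpotent_abelian A n : connected A -> subgroup A ->
  lower_central A n.+1 `<=` [set 1] ->
  forall x y, A x -> A y -> commute x y.
Proof.
move=> cA gA; elim: n => [|n IH] A1; last exact/IH/connected_lower_central_eq1.
by move=> x y Ax Ay; apply/commgP/eqP; apply: A1; exact: mem_comm.
Qed.

End identity_component.

Theorem theorem1p2 (R : realType) (k : nat) (k_gt0 : (0 < k)%N)
    (G : topologicalGroupType)
    (G_compact : compact [set: G]) (G_hausdorff : hausdorff_space G)
    (mu : probability (borel (gpower G k.+1)) R) (mu_haar : normalized_haar mu)
    (np_gt0 : (0 < np G k mu)%E) :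
  (forall x y : G, identity_component G x -> identity_component G y ->
     commute x y) /\
  exists N : set G,
    [/\ closed N, normal_subgroup N, nilpotent_class_le N k
      & open [set x * y | x in identity_component G & y in N]].
Proof.
have [N [nN oN N1]] := virtually_nilpotent mu_haar G_compact G_hausdorff np_gt0.
have [gN _] := nN.
have [J [mJ J_inv]] := haar_invariant_mean mu_haar G_compact.
split.
  case: k k_gt0 {mu mu_haar np_gt0} N1 => // n _ N1.
  apply: (connected_nilpotent_abelian mJ J_inv G_compact G_hausdorff (n := n)).
  - exact: component_connected.
  - exact: identity_component_subgroup.
  rewrite -N1; apply: lower_central_mono; exact: identity_component_sub.
exists N; split=> //; first exact: open_subgroup_closed.
rewrite (_ : image2 _ _ _ = [set g | exists2 x, identity_component G x & N (x^-1 * g)]).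
  exact: open_translates.
apply/seteqP; split=> [_ [x Ax [y Ny <-]]|g [x Ax Nxg]].
  by exists x => //; rewrite mulKg.
by exists x => //; exists (x^-1 * g) => //; rewrite mulVKg.
Qed.
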